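(* Let $\sigma_1\in(p-1,+\infty)$, $\sigma_2\in(q-1,+\infty)$, and put $$\mathcal{K}=\{(\tau,s):\tau+s>0,\ \tau\le1,\ -\tau^2-s^2-\tau s+\tau+s+1>0\},$$ $$\overline{\mathcal{K}}=\{(\tau,s):\tau+s>0,\ s\le1,\ -\tau^2-s^2-\tau s+\tau+s+1>0\}.$$ The GS-ADMM iteration, after replacing the index $k+1$ by $k$ for the $\mathbf{x}$ and $\lambda$ iterates, is the re-indexed algorithm described in the context, in which $\mathbf{x}$ and $\mathbf{y}$ play exchanged roles. Applying to it the global convergence theorem and the ergodic rate theorem for GS-ADMM (which hold for $(\tau,s)\in\mathcal{K}$), it also converges and has the $O(1/t)$ convergence rate when $(\tau,s)\in\overline{\mathcal{K}}$. Hence the convergence domain $\mathcal{K}$ in these two theorems can be enlarged to the symmetric domain $$\mathcal{G}=\mathcal{K}\cup\overline{\mathcal{K}}=\{(\tau,s):\ \tau+s>0,\ -\tau^2-s^2-\tau s+\tau+s+1>0\}.$$ Explicitly: (i) (Global convergence.) For every $(\tau,s)\in\mathcal{G}$, the sequences generated by GS-ADMM satisfy $\lim_{k\to\infty}\big(\sum_{i=1}^p\|A_i(x_i^k-x_i^{k+1})\|^2+\sum_{j=1}^q\|B_j(y_j^k-y_j^{k+1})\|^2\big)=0$ and $\lim_{k\to\infty}\|\mathcal{A}\mathbf{x}^k+\mathcal{B}\mathbf{y}^k-c\|=0$, and there exists $\mathbf{w}^\infty\in\mathcal{M}^*$ with $\lim_{k\to\infty}\widetilde{\mathbf{w}}^k=\mathbf{w}^\infty$.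 (ii) (Ergodic rate.) If $(\tau,s)\in\mathcal{K}$, there exist $\xi_3,\xi_4\ge0$ such that the GS-ADMM sequences satisfy, for all $t\ge1$ and all $\mathbf{w}\in\mathcal{M}$, with $\mathbf{w}_t=\frac1t\sum_{k=1}^t\widetilde{\mathbf{w}}^k$ and $\mathbf{u}_t=\frac1t\sum_{k=1}^t\widetilde{\mathbf{u}}^k$, $$h(\mathbf{u}_t)-h(\mathbf{u})+\langle\mathbf{w}_t-\mathbf{w},\mathcal{J}(\mathbf{w})\rangle\le\frac1{2t}\Big(\|\mathbf{w}-\mathbf{w}^1\|_H^2+\xi_3\|\mathcal{A}\mathbf{x}^1+\mathcal{B}\mathbf{y}^1-c\|^2+\xi_4\|\mathbf{y}^1-\mathbf{y}^0\|_{H_{\mathbf{y}}}^2\Big).$$ If $(\tau,s)\in\overline{\mathcal{K}}$, the same theorem applied to the re-indexed algorithm gives $\xi_3,\xi_4\ge0$ such that the sequences of the re-indexed algorithm satisfy, for all $t\ge1$ and all $\mathbf{w}\in\mathcal{M}$, with $\mathbf{w}_t=\frac1t\sum_{k=1}^t\widehat{\mathbf{w}}^k$ and $\mathbf{u}_t=\frac1t\sum_{k=1}^t(\mathbf{x}^{k+1};\mathbf{y}^{k+1})$, $$h(\mathbf{u}_t)-h(\mathbf{u})+\langle\mathbf{w}_t-\mathbf{w},\mathcal{J}(\mathbf{w})\rangle\le\frac1{2t}\Big(\|\mathbf{w}-\mathbf{z}^1\|_{H'}^2+\xi_3\|\mathcal{A}\mathbf{x}^1+\mathcal{B}\mathb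f{y}^1-c\|^2+\xi_4\|\mathbf{x}^1-\mathbf{x}^0\|_{H_{\mathbf{x}}}^2\Big).$$
   Context: Setting. $p,q\ge1$ are integers; $f_i:\mathbb{R}^{m_i}\to\mathbb{R}$ ($1\le i\le p$) and $g_j:\mathbb{R}^{d_j}\to\mathbb{R}$ ($1\le j\le q$) are closed proper convex functions; $A_i\in\mathbb{R}^{n\times m_i}$, $B_j\in\mathbb{R}^{n\times d_j}$ all have full column rank; $c\in\mathbb{R}^n$; $\mathcal{X}_i\subset\mathbb{R}^{m_i}$, $\mathcal{Y}_j\subset\mathbb{R}^{d_j}$ are closed convex sets. The problem is: minimize $\sum_i f_i(x_i)+\sum_j g_j(y_j)$ subject to $\sum_i A_ix_i+\sum_j B_jy_j=c$, $x_i\in\mathcal{X}_i$, $y_j\in\mathcal{Y}_j$; its solution set is assumed nonempty. Notation. $\mathcal{A}=(A_1,\dots,A_p)$, $\mathcal{B}=(B_1,\dots,B_q)$, $\mathbf{x}=(x_1;\dots;x_p)$, $\mathbf{y}=(y_1;\dots;y_q)$, $\mathcal{X}=\prod_i\mathcal{X}_i$, $\mathcal{Y}=\prod_j\mathcal{Y}_j$, $\mathcal{M}=\mathcal{X}\times\mathcal{Y}\times\mathbb{R}^n$, $\mathbf{u}=(\mathbf{x};\mathbf{y})$, $\mathbf{w}=(\mathbf{x};\mathbf{y};\lambda)$, $h(\mathbf{u})=\sum_{i=1}^pf_i(x_i)+\sum_{j=1}^qg_j(y_j)$, $\mathcal{J}(\mathbf{w})=(-\mathcal{A}^{\sf T}\lambda;\,-\mathcal{B}^{\sf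 T}\lambda;\,\mathcal{A}\mathbf{x}+\mathcal{B}\mathbf{y}-c)$, $\|v\|_P^2=v^{\sf T}Pv$ for symmetric $P$. For $\beta>0$, $\mathcal{L}_\beta(\mathbf{x},\mathbf{y},\lambda)=h(\mathbf{u})-\langle\lambda,\mathcal{A}\mathbf{x}+\mathcal{B}\mathbf{y}-c\rangle+\frac{\beta}{2}\|\mathcal{A}\mathbf{x}+\mathcal{B}\mathbf{y}-c\|^2$. $\mathcal{M}^*$ is the set of $\mathbf{w}^*\in\mathcal{M}$ with $h(\mathbf{u})-h(\mathbf{u}^* )+\langle\mathbf{w}-\mathbf{w}^*,\mathcal{J}(\mathbf{w}^* )\rangle\ge0$ for all $\mathbf{w}\in\mathcal{M}$. GS-ADMM (parameters $\beta>0,\sigma_1,\sigma_2,\tau,s$). From an initial $\mathbf{w}^0=(\mathbf{x}^0;\mathbf{y}^0;\lambda^0)\in\mathcal{M}$, for $k=0,1,2,\dots$: (1) for each $i$, $x_i^{k+1}=\arg\min_{x_i\in\mathcal{X}_i}\mathcal{L}_\beta(x_1^k,\dots,x_i,\dots,x_p^k,\mathbf{y}^k,\lambda^k)+\frac{\sigma_1\beta}{2}\|A_i(x_i-x_i^k)\|^2$; (2) $\lambda^{k+\frac12}=\lambda^k-\tau\beta(\mathcal{A}\mathbf{x}^{k+1}+\mathcal{B}\mathbf{y}^k-c)$; (3) for each $j$, $y_j^{k+1}=\arg\min_{y_j\in\mathcal{Y}_j}\mathcal{L}_\beta(\mathbf{x}^{k+1},y_1^k,\dots,y_j,\dots,y_q^k,\lambda^{k+\frac12})+\frac{\sigma_2\beta}{2}\|B_j(y_j-y_j^k)\|^2$;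 (4) $\lambda^{k+1}=\lambda^{k+\frac12}-s\beta(\mathcal{A}\mathbf{x}^{k+1}+\mathcal{B}\mathbf{y}^{k+1}-c)$. Here $\mathbf{w}^k=(\mathbf{x}^k;\mathbf{y}^k;\lambda^k)$, $\widetilde{\mathbf{u}}^k=(\mathbf{x}^{k+1};\mathbf{y}^{k+1})$, and $\widetilde{\mathbf{w}}^k=(\mathbf{x}^{k+1};\mathbf{y}^{k+1};\widetilde\lambda^k)$ with $\widetilde\lambda^k=\lambda^k-\beta(\mathcal{A}\mathbf{x}^{k+1}+\mathcal{B}\mathbf{y}^k-c)$. Re-indexed algorithm. The same iteration, with the index $k+1$ replaced by $k$ for the $\mathbf{x}$ and $\lambda$ iterates; from $\mathbf{x}^0,\mathbf{y}^0,\lambda^{-\frac12}$, for $k=0,1,2,\dots$: (1') for each $j$, $y_j^{k+1}=\arg\min_{y_j\in\mathcal{Y}_j}\mathcal{L}_\beta(\mathbf{x}^k,y_1^k,\dots,y_j,\dots,y_q^k,\lambda^{k-\frac12})+\frac{\sigma_2\beta}{2}\|B_j(y_j-y_j^k)\|^2$; (2') $\lambda^k=\lambda^{k-\frac12}-s\beta(\mathcal{A}\mathbf{x}^k+\mathcal{B}\mathbf{y}^{k+1}-c)$; (3') for each $i$, $x_i^{k+1}=\arg\min_{x_i\in\mathcal{X}_i}\mathcal{L}_\beta(x_1^k,\dots,x_i,\dots,x_p^k,\mathbf{y}^{k+1},\lambda^k)+\frac{\sigma_1\beta}{2}\|A_i(x_i-x_i^k)\|^2$; (4') $\lambda^{k+\frac12}=\lambda^k-\tau\beta(\mathcal{A}\mathbf{x}^{k+1}+\mathcal{B}\mathbf{y}^{k+1}-c)$.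 For this algorithm put $\mathbf{z}^k=(\mathbf{x}^k;\mathbf{y}^k;\lambda^{k-\frac12})$ and $\widehat{\mathbf{w}}^k=(\mathbf{x}^{k+1};\mathbf{y}^{k+1};\lambda^{k-\frac12}-\beta(\mathcal{A}\mathbf{x}^k+\mathcal{B}\mathbf{y}^{k+1}-c))$. Matrices. $H_{\mathbf{x}}$ is the $p\times p$ block matrix with diagonal blocks $\sigma_1\beta A_i^{\sf T}A_i$ and off-diagonal blocks $-\beta A_i^{\sf T}A_l$; $H_{\mathbf{y}}$ is the $q\times q$ block matrix with diagonal blocks $\sigma_2\beta B_j^{\sf T}B_j$ and off-diagonal blocks $-\beta B_j^{\sf T}B_l$. $H$ is the symmetric matrix, acting on $(\mathbf{x};\mathbf{y};\lambda)$, that is block diagonal with blocks $H_{\mathbf{x}}$ (on $\mathbf{x}$) and $\widetilde H$ (on $(\mathbf{y};\lambda)$), where $\widetilde H$ has $(y_j,y_j)$ block $(\sigma_2+1-\frac{\tau s}{\tau+s})\beta B_j^{\sf T}B_j$, $(y_j,y_l)$ block $-\frac{\tau s}{\tau+s}\beta B_j^{\sf T}B_l$ for $j\ne l$, $(y_j,\lambda)$ block $-\frac{\tau}{\tau+s}B_j^{\sf T}$ and $(\lambda,\lambda)$ block $\frac{1}{\beta(\tau+s)}I$. $H'$ is obtained from $H$ by exchanging the roles $\mathbf{x}\leftrightarrow\mathbf{y}$, $A\leftrightarrow B$, $p\leftrightarrow q$, $\sigma_1\leftrightarrow\sigma_2$, $\tau\leftrightarrow s$: it is block diagonal with blocks $H_{\mathbf{y}}$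 (on $\mathbf{y}$) and a block on $(\mathbf{x};\lambda)$ with $(x_i,x_i)$ block $(\sigma_1+1-\frac{\tau s}{\tau+s})\beta A_i^{\sf T}A_i$, $(x_i,x_l)$ block $-\frac{\tau s}{\tau+s}\beta A_i^{\sf T}A_l$ for $i\ne l$, $(x_i,\lambda)$ block $-\frac{s}{\tau+s}A_i^{\sf T}$ and $(\lambda,\lambda)$ block $\frac{1}{\beta(\tau+s)}I$.
   Formalization: The convergence claims, for GS-ADMM on G and for the re-indexed algorithm, additionally assume that M* is nonempty; nonemptiness of the problem's solution set alone does not guarantee this, and the claimed limit in M* fails without it. *)

(* Defs.v *)
From mathcomp Require Import all_boot all_order all_algebra.
From mathcomp Require Import all_classical all_reals all_analysis.

Set Implicit Arguments.
Unset Strict Implicit.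
Unset Printing Implicit Defensive.

Import Order.TTheory GRing.Theory Num.Theory.
Import numFieldNormedType.Exports.

Local Open Scope classical_set_scope.
Local Open Scope ring_scope.

(* The library norm on matrices is the sup norm, so the Euclidean inner
   product, the Euclidean norm and v^T P v are introduced here. *)
Definition dotv (R : realType) (n : nat) (u v : 'cV[R]_n) : R :=
  (u^T *m v) 0 0.

Definition enorm (R : realType) (n : nat) (v : 'cV[R]_n) : R :=
  Num.sqrt (dotv v v).

Definition qnorm2 (R : realType) (n : nat) (P : 'M[R]_n) (v : 'cV[R]_n) : R :=
  (v^T *m P *m v) 0 0.

(* Functions are real valued, hence automatically proper; "closed" means
   that the epigraph is closed. *)
Definition closed_proper_convex (R : realType) (n : nat)
    (f : 'cV[R]_n -> R) : Prop :=
  closed [set z : 'cV[R]_n * R | f z.1 <= z.2] /\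
  convex_function [set: 'cV[R]_n] f.

Definition is_argmin (R : realType) (T : Type) (D : set T) (F : T -> R)
    (a : T) : Prop :=
  D a /\ forall b, D b -> F a <= F b.

(* Data of: minimize sum_i f_i(x_i) + sum_j g_j(y_j) subject to
   sum_i A_i x_i + sum_j B_j y_j = c, x_i in X_i, y_j in Y_j. *)
Record problem (R : realType) := Problem {
  np : nat;
  nq : nat;
  nc : nat;
  dimx : 'I_np -> nat;
  dimy : 'I_nq -> nat;
  fobj : forall i, 'cV[R]_(dimx i) -> R;
  gobj : forall j, 'cV[R]_(dimy j) -> R;
  Amx : forall i, 'M[R]_(nc, dimx i);
  Bmx : forall j, 'M[R]_(nc, dimy j);
  cvec : 'cV[R]_nc;
  Xset : forall i, set 'cV[R]_(dimx i);
  Yset : forall j, set 'cV[R]_(dimy j)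
}.

Arguments dimx {R} p i : rename.
Arguments dimy {R} p j : rename.
Arguments fobj {R} p i _ : rename.
Arguments gobj {R} p j _ : rename.
Arguments Amx {R} p i : rename.
Arguments Bmx {R} p j : rename.
Arguments Xset {R} p i _ : rename.
Arguments Yset {R} p j _ : rename.

Section Problem.
Variables (R : realType) (P : problem R).

(* x = (x_1; ...; x_p), y = (y_1; ...; y_q), u = (x; y), w = (u; lambda). *)
Definition xvec := 'cV[R]_(\sum_(i < np P) dimx P i).
Definition yvec := 'cV[R]_(\sum_(j < nq P) dimy P j).
Definition lvec := 'cV[R]_(nc P).
Definition uvec :=
  'cV[R]_(\sum_(i < np P) dimx P i + \sum_(j < nq P) dimy P j).
Definition wvec :=
  'cV[R]_(\sum_(i < np P) dimx P i + \sum_(j < nq P) dimy P j + nc P).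

Definition xblk (x : xvec) (i : 'I_(np P)) : 'cV[R]_(dimx P i) :=
  submxcol x i.
Definition yblk (y : yvec) (j : 'I_(nq P)) : 'cV[R]_(dimy P j) :=
  submxcol y j.

(* (x_1; ...; x_{i-1}; xi; x_{i+1}; ...; x_p), and similarly for y *)
Definition xsubst (x : xvec) (i : 'I_(np P)) (xi : 'cV[R]_(dimx P i)) : xvec :=
  \mxcol_l dfwith (xblk x) i xi l.
Definition ysubst (y : yvec) (j : 'I_(nq P)) (yj : 'cV[R]_(dimy P j)) : yvec :=
  \mxcol_l dfwith (yblk y) j yj l.

Definition mku (x : xvec) (y : yvec) : uvec := col_mx x y.
Definition mkw (x : xvec) (y : yvec) (lam : lvec) : wvec :=
  col_mx (mku x y) lam.

Definition ux (u : uvec) : xvec := usubmx u.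
Definition uy (u : uvec) : yvec := dsubmx u.
Definition wu (w : wvec) : uvec := usubmx w.
Definition wx (w : wvec) : xvec := ux (wu w).
Definition wy (w : wvec) : yvec := uy (wu w).
Definition wl (w : wvec) : lvec := dsubmx w.

Definition calA : 'M[R]_(nc P, \sum_(i < np P) dimx P i) :=
  \mxrow_i Amx P i.
Definition calB : 'M[R]_(nc P, \sum_(j < nq P) dimy P j) :=
  \mxrow_j Bmx P j.

Definition resid (x : xvec) (y : yvec) : lvec :=
  calA *m x + calB *m y - cvec P.

Definition hobj (u : uvec) : R :=
  \sum_(i < np P) fobj P i (xblk (ux u) i) +
  \sum_(j < nq P) gobj P j (yblk (uy u) j).

Definition calX : set xvec := [set x | forall i, Xset P i (xblk x i)].
Definition calY : set yvec := [set y | forall j, Yset P j (yblk y j)].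
Definition calM : set wvec := [set w | calX (wx w) /\ calY (wy w)].

Definition feasible : set uvec :=
  [set u | [/\ calX (ux u), calY (uy u) & resid (ux u) (uy u) = 0]].
Definition solution_set : set uvec := [set u | is_argmin feasible hobj u].

Definition calJ (w : wvec) : wvec :=
  mkw (- (calA^T *m wl w)) (- (calB^T *m wl w)) (resid (wx w) (wy w)).

Definition Mstar : set wvec :=
  [set ws | calM ws /\ forall w, calM w ->
     0 <= hobj (wu w) - hobj (wu ws) + dotv (w - ws) (calJ ws)].

Definition auglag (beta : R) (x : xvec) (y : yvec) (lam : lvec) : R :=
  hobj (mku x y) - dotv lam (resid x y) + beta / 2 * enorm (resid x y) ^+ 2.

Section Algorithms.
Variables beta sigma1 sigma2 tau s : R.

(* [xn] minimizes block by block, in parallel, the proximal augmented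
   Lagrangian at the previous point [x], with [y] and [lam] fixed. *)
Definition x_step (x : xvec) (y : yvec) (lam : lvec) (xn : xvec) : Prop :=
  forall i, is_argmin (Xset P i)
    (fun xi => auglag beta (xsubst x xi) y lam +
       sigma1 * beta / 2 * enorm (Amx P i *m (xi - xblk x i)) ^+ 2)
    (xblk xn i).

Definition y_step (x : xvec) (y : yvec) (lam : lvec) (yn : yvec) : Prop :=
  forall j, is_argmin (Yset P j)
    (fun yj => auglag beta x (ysubst y yj) lam +
       sigma2 * beta / 2 * enorm (Bmx P j *m (yj - yblk y j)) ^+ 2)
    (yblk yn j).

(* [lamh k] is lambda^{k + 1/2}. *)
Definition gs_admm (x : nat -> xvec) (y : nat -> yvec)
    (lam lamh : nat -> lvec) : Prop :=
  calM (mkw (x 0%N) (y 0%N) (lam 0%N)) /\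
  forall k : nat,
  [/\ x_step (x k) (y k) (lam k) (x k.+1),
      lamh k = lam k - (tau * beta) *: resid (x k.+1) (y k),
      y_step (x k.+1) (y k) (lamh k) (y k.+1) &
      lam k.+1 = lamh k - (s * beta) *: resid (x k.+1) (y k.+1)].

(* Here [lamh k] is lambda^{k - 1/2}, so that [lamh 0] is the initial
   multiplier and [lamh k.+1] is lambda^{k + 1/2}. *)
Definition gs_admm_reindexed (x : nat -> xvec) (y : nat -> yvec)
    (lam lamh : nat -> lvec) : Prop :=
  forall k : nat,
  [/\ y_step (x k) (y k) (lamh k) (y k.+1),
      lam k = lamh k - (s * beta) *: resid (x k) (y k.+1),
      x_step (x k) (y k.+1) (lam k) (x k.+1) &
      lamh k.+1 = lam k - (tau * beta) *: resid (x k.+1) (y k.+1)].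

Definition utilde (x : nat -> xvec) (y : nat -> yvec) (k : nat) : uvec :=
  mku (x k.+1) (y k.+1).

Definition wtilde (x : nat -> xvec) (y : nat -> yvec) (lam : nat -> lvec)
    (k : nat) : wvec :=
  mkw (x k.+1) (y k.+1) (lam k - beta *: resid (x k.+1) (y k)).

(* [lamh k] is lambda^{k - 1/2}, as in [gs_admm_reindexed]. *)
Definition what (x : nat -> xvec) (y : nat -> yvec) (lamh : nat -> lvec)
    (k : nat) : wvec :=
  mkw (x k.+1) (y k.+1) (lamh k - beta *: resid (x k) (y k.+1)).

Definition Hx : 'M[R]_(\sum_(i < np P) dimx P i) :=
  \mxblock_(i, l) ((if i == l then sigma1 * beta else - beta) *:
                   ((Amx P i)^T *m Amx P l)).

Definition Hy : 'M[R]_(\sum_(j < nq P) dimy P j) :=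
  \mxblock_(j, l) ((if j == l then sigma2 * beta else - beta) *:
                   ((Bmx P j)^T *m Bmx P l)).

(* (y, y), (y, lambda) and (lambda, lambda) blocks of H *)
Definition Hyy : 'M[R]_(\sum_(j < nq P) dimy P j) :=
  \mxblock_(j, l) ((if j == l then (sigma2 + 1 - tau * s / (tau + s)) * beta
                    else - (tau * s / (tau + s)) * beta) *:
                   ((Bmx P j)^T *m Bmx P l)).
Definition Hyl : 'M[R]_(\sum_(j < nq P) dimy P j, nc P) :=
  \mxcol_j (- (tau / (tau + s)) *: (Bmx P j)^T).
Definition Hll : 'M[R]_(nc P) := (beta * (tau + s))^-1%:M.

Definition Hmx :
    'M[R]_(\sum_(i < np P) dimx P i + \sum_(j < nq P) dimy P j + nc P) :=
  block_mx (block_mx Hx 0 0 Hyy) (col_mx 0 Hyl) (row_mx 0 Hyl^T) Hll.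

(* (x, x) and (x, lambda) blocks of H' *)
Definition Hxx' : 'M[R]_(\sum_(i < np P) dimx P i) :=
  \mxblock_(i, l) ((if i == l then (sigma1 + 1 - tau * s / (tau + s)) * beta
                    else - (tau * s / (tau + s)) * beta) *:
                   ((Amx P i)^T *m Amx P l)).
Definition Hxl' : 'M[R]_(\sum_(i < np P) dimx P i, nc P) :=
  \mxcol_i (- (s / (tau + s)) *: (Amx P i)^T).

Definition Hmx' :
    'M[R]_(\sum_(i < np P) dimx P i + \sum_(j < nq P) dimy P j + nc P) :=
  block_mx (block_mx Hxx' 0 0 Hy) (col_mx Hxl' 0) (row_mx Hxl'^T 0) Hll.

End Algorithms.

Definition successive_diff2 (x : nat -> xvec) (y : nat -> yvec) (k : nat) : R :=
  \sum_(i < np P) enorm (Amx P i *m (xblk (x k) i - xblk (x k.+1) i)) ^+ 2 +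
  \sum_(j < nq P) enorm (Bmx P j *m (yblk (y k) j - yblk (y k.+1) j)) ^+ 2.

End Problem.

Arguments calX {R} P _.
Arguments calY {R} P _.
Arguments calM {R} P _.
Arguments feasible {R} P _.
Arguments solution_set {R} P _.
Arguments Mstar {R} P _.

Section Domains.
Variable R : realType.

Definition Kdom : set (R * R) :=
  [set ts | [/\ 0 < ts.1 + ts.2, ts.1 <= 1 &
     0 < - ts.1 ^+ 2 - ts.2 ^+ 2 - ts.1 * ts.2 + ts.1 + ts.2 + 1]].

Definition Kbar : set (R * R) :=
  [set ts | [/\ 0 < ts.1 + ts.2, ts.2 <= 1 &
     0 < - ts.1 ^+ 2 - ts.2 ^+ 2 - ts.1 * ts.2 + ts.1 + ts.2 + 1]].

Definition Gdom : set (R * R) :=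
  [set ts | 0 < ts.1 + ts.2 /\
     0 < - ts.1 ^+ 2 - ts.2 ^+ 2 - ts.1 * ts.2 + ts.1 + ts.2 + 1].

End Domains.

Arguments Kdom R _ : clear implicits.
Arguments Kbar R _ : clear implicits.
Arguments Gdom R _ : clear implicits.

(* (1 / t) * (v^1 + ... + v^t) *)
Definition ergodic_mean (R : realType) (n : nat) (v : nat -> 'cV[R]_n)
    (t : nat) : 'cV[R]_n :=
  t%:R^-1 *: \sum_(1 <= k < t.+1) v k.

(* Main.v *)
(* Both partial sweeps are proximal steps: summing the first-order conditions of
   the blocks, the x-sweep and the y-sweep become variational inequalities with
   the matrices H_x and H_y.  The method is thus a two-block scheme, and the
   re-indexed algorithm is the same scheme with (x, A, tau) and (y, B, s)
   exchanged, so one analysis under tau <= 1 covers both halves of the domain.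

   With r the residual, d = B (y^k - y^(k+1)), and the norm Phi of H, a step
   satisfies
     2 gap(w) <= Phi(w - w^k) - Phi(w - w^(k+1)) - |dx|_(H_x)^2 - |dy|_(H_y)^2
       - beta ((1-tau) |d|^2 + 2 (1-tau) <d, r> + (2-tau-s) |r|^2).
   The optimality conditions of two successive y-sweeps, tested at each other's
   minimizer, bound <d, r> below by the previous residual, and Young's inequality
   then leaves a positive multiple of |r|^2 exactly when
   - tau^2 - s^2 - tau s + tau + s + 1 > 0.  Summation gives the ergodic rate;
   for convergence, the decreasing quantity at a saddle point bounds the
   iterates, a cluster point is a saddle point, and the decreasing quantity
   measured at that cluster point tends to 0. *)

Require Import Defs.
From mathcomp Require Import all_boot all_order all_algebra.
From mathcomp Require Import all_classical all_reals all_analysis.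
From mathcomp Require Import ring lra.

Set Implicit Arguments.
Unset Strict Implicit.
Unset Printing Implicit Defensive.

Import Order.TTheory GRing.Theory Num.Theory.
Import numFieldNormedType.Exports.

Local Open Scope classical_set_scope.
Local Open Scope ring_scope.

(** * Inner products and convergence of matrices *)

Section InnerProduct.
Variable R : realType.

Lemma dotvE n (u v : 'cV[R]_n) : dotv u v = \sum_i u i 0 * v i 0.
Proof. by rewrite /dotv mxE; apply: eq_bigr => i _; rewrite mxE. Qed.

Lemma dotvC n (u v : 'cV[R]_n) : dotv u v = dotv v u.
Proof. by rewrite !dotvE; apply: eq_bigr => i _; rewrite mulrC. Qed.

Lemma dotvDl n (u v w : 'cV[R]_n) : dotv (u + v) w = dotv u w + dotv v w.
Proof. by rewrite /dotv linearD mulmxDl mxE. Qed.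

Lemma dotvNl n (u w : 'cV[R]_n) : dotv (- u) w = - dotv u w.
Proof. by rewrite /dotv linearN mulNmx mxE. Qed.

Lemma dotvZl n a (u w : 'cV[R]_n) : dotv (a *: u) w = a * dotv u w.
Proof. by rewrite /dotv linearZ -scalemxAl mxE. Qed.

Lemma dotvDr n (u v w : 'cV[R]_n) : dotv w (u + v) = dotv w u + dotv w v.
Proof. by rewrite dotvC dotvDl !(dotvC w). Qed.

Lemma dotvNr n (u w : 'cV[R]_n) : dotv w (- u) = - dotv w u.
Proof. by rewrite dotvC dotvNl (dotvC w). Qed.

Lemma dotvZr n a (u w : 'cV[R]_n) : dotv w (a *: u) = a * dotv w u.
Proof. by rewrite dotvC dotvZl (dotvC w). Qed.

Definition dotv_bilin := (dotvDl, dotvDr, dotvNl, dotvNr, dotvZl, dotvZr).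

Lemma dotv0l n (w : 'cV[R]_n) : dotv 0 w = 0.
Proof. by rewrite -(scale0r 0) dotvZl mul0r. Qed.

Lemma dotv0r n (w : 'cV[R]_n) : dotv w 0 = 0.
Proof. by rewrite dotvC dotv0l. Qed.

Lemma dotv_sumr n (I : Type) (r : seq I) (Q : pred I) (F : I -> 'cV[R]_n) w :
  dotv w (\sum_(i <- r | Q i) F i) = \sum_(i <- r | Q i) dotv w (F i).
Proof.
by apply: (big_morph (dotv w)) => [u v|]; rewrite ?dotvDr ?dotv0r.
Qed.

Lemma dotv_suml n (I : Type) (r : seq I) (Q : pred I) (F : I -> 'cV[R]_n) w :
  dotv (\sum_(i <- r | Q i) F i) w = \sum_(i <- r | Q i) dotv (F i) w.
Proof. by rewrite dotvC dotv_sumr; apply: eq_bigr => i _; rewrite dotvC. Qed.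

Lemma dotv_ge0 n (u : 'cV[R]_n) : 0 <= dotv u u.
Proof. by rewrite dotvE; apply: sumr_ge0 => i _; rewrite -expr2 sqr_ge0. Qed.

Lemma sqr_coord_le_dotv n (u : 'cV[R]_n) i : u i 0 ^+ 2 <= dotv u u.
Proof.
rewrite dotvE (bigD1 i) //= -expr2 lerDl sumr_ge0 // => j _.
by rewrite -expr2 sqr_ge0.
Qed.

Lemma dotv_trmx m n (M : 'M[R]_(m, n)) u v :
  dotv u (M^T *m v) = dotv (M *m u) v.
Proof. by rewrite /dotv trmx_mul mulmxA. Qed.

Lemma enorm_sqr n (u : 'cV[R]_n) : enorm u ^+ 2 = dotv u u.
Proof. by rewrite /enorm sqr_sqrtr // dotv_ge0. Qed.

Lemma qnorm2E n (H : 'M[R]_n) u : qnorm2 H u = dotv u (H *m u).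
Proof. by rewrite /qnorm2 /dotv mulmxA. Qed.

Lemma dotv_col_mx m n (a c : 'cV[R]_m) (b d : 'cV[R]_n) :
  dotv (col_mx a b) (col_mx c d) = dotv a c + dotv b d.
Proof. by rewrite /dotv tr_col_mx mul_row_col mxE. Qed.

Lemma dotv_mxcol p (D : 'I_p -> nat) (u v : 'cV[R]_(\sum_i D i)) :
  dotv u v = \sum_i dotv (submxcol u i) (submxcol v i).
Proof.
rewrite -[in LHS](submxcolK u) -[in LHS](submxcolK v) /dotv tr_mxcol.
by rewrite mul_mxrow_mxcol summxE.
Qed.

(* Every (u_i - u_j)^2 is nonnegative. *)
Lemma sqr_sum_le_card p (F : 'I_p -> R) :
  (\sum_i F i) ^+ 2 <= p%:R * \sum_i F i ^+ 2.
Proof.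
have: 0 <= \sum_i \sum_j (F i - F j) ^+ 2.
  by apply: sumr_ge0 => i _; apply: sumr_ge0 => j _; rewrite sqr_ge0.
have -> : \sum_i \sum_j (F i - F j) ^+ 2 =
    2 * (p%:R * \sum_i F i ^+ 2 - (\sum_i F i) ^+ 2).
  transitivity (\sum_i (p%:R * F i ^+ 2 - 2 * (F i * \sum_j F j)
      + \sum_j F j ^+ 2)).
    apply: eq_bigr => i _.
    transitivity (\sum_j (F i ^+ 2 - 2 * (F i * F j) + F j ^+ 2)).
      by apply: eq_bigr => j _; ring.
    by rewrite big_split sumrB sumr_const card_ord -[_ *+ p]mulr_natl -!mulr_sumr.
  rewrite big_split /= sumrB -!mulr_sumr -mulr_suml sumr_const card_ord.
  by ring.
by rewrite pmulr_rge0 // subr_ge0.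
Qed.

Lemma dotv_sum_le_card n p (F : 'I_p -> 'cV[R]_n) :
  dotv (\sum_i F i) (\sum_i F i) <= p%:R * \sum_i dotv (F i) (F i).
Proof.
rewrite dotvE.
have -> : \sum_i dotv (F i) (F i) = \sum_i \sum_j F i j 0 ^+ 2.
  by apply: eq_bigr => i _; rewrite dotvE; apply: eq_bigr => j _; rewrite expr2.
rewrite exchange_big /= mulr_sumr ler_sum // => j _.
by rewrite summxE -expr2 sqr_sum_le_card.
Qed.

(** Row by row, the squared sum of [n] products is at most [n] times the sum of their squares.
    Applied to a left inverse, the bound later gives coercivity under full column rank. *)
Lemma dotv_mulmx_bound m n (M : 'M[R]_(m, n)) :
  exists2 C, 0 <= C & forall v, dotv (M *m v) (M *m v) <= C * dotv v v.
Proof.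
exists (\sum_i n%:R * \sum_j M i j ^+ 2).
  apply: sumr_ge0 => i _; apply: mulr_ge0 => //.
  by apply: sumr_ge0 => j _; rewrite sqr_ge0.
move=> v; rewrite dotvE mulr_suml; apply: ler_sum => i _.
rewrite -expr2 mxE (le_trans (sqr_sum_le_card _)) // -mulrA ler_wpM2l //.
rewrite mulr_suml; apply: ler_sum => j _.
by rewrite exprMn ler_wpM2l ?sqr_ge0 // sqr_coord_le_dotv.
Qed.

End InnerProduct.

(** * Entrywise limits, subsequences and compactness *)

Section MatrixConvergence.
Variable R : realType.

Lemma cvg_mxP m n (u : nat -> 'M[R]_(m, n)) (l : 'M[R]_(m, n)) :
  u k @[k --> \oo] --> l <->
  forall i j, u k i j @[k --> \oo] --> l i j.
Proof.
split=> [ul i j|ul].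
  exact: (cvg_comp u (fun M : 'M[R]_(m, n) => M i j) ul (@coord_continuous _ _ _ i j l)).
apply/cvg_ballP => e e0.
have : forall ij : 'I_m * 'I_n,
    \forall k \near \oo, ball (l ij.1 ij.2) e (u k ij.1 ij.2).
  by move=> ij; have /cvg_ballP/(_ _ e0) := ul ij.1 ij.2.
move=> /filter_forall H; near=> k.
split=> // i j.
have : forall ij : 'I_m * 'I_n, ball (l ij.1 ij.2) e (u k ij.1 ij.2).
  by near: k; exact: H.
by move=> /(_ (i, j)).
Unshelve. all: by end_near. Qed.

Lemma cvg_sum_ord p (F : 'I_p -> nat -> R) (l : 'I_p -> R) :
  (forall i, F i k @[k --> \oo] --> l i) ->
  \sum_i F i k @[k --> \oo] --> \sum_i l i.
Proof.
move=> Fl; elim: (index_enum _) => [|i r IH].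
  by under eq_fun do rewrite big_nil; rewrite big_nil; exact: cvg_cst.
under eq_fun do rewrite big_cons.
by rewrite big_cons; apply: cvgD.
Qed.

Lemma cvg_mulmx m n p (M : 'M[R]_(m, n)) (u : nat -> 'M[R]_(n, p)) l :
  u k @[k --> \oo] --> l -> M *m u k @[k --> \oo] --> M *m l.
Proof.
move=> /cvg_mxP ul; apply/cvg_mxP => i j; rewrite mxE.
under eq_fun do rewrite mxE.
by apply: cvg_sum_ord => h; apply: cvgMr; exact: ul.
Qed.

Lemma cvg_dotv n (u v : nat -> 'cV[R]_n) l l' :
  u k @[k --> \oo] --> l -> v k @[k --> \oo] --> l' ->
  dotv (u k) (v k) @[k --> \oo] --> dotv l l'.
Proof.
move=> /cvg_mxP ul /cvg_mxP vl; rewrite dotvE.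
under eq_fun do rewrite dotvE.
by apply: cvg_sum_ord => h; apply: cvgM; [exact: ul|exact: vl].
Qed.

(** Passes from the Euclidean norm to the matrix topology: each squared entry is at most the squared
    norm. *)
Lemma cvg_dotv0 n (u : nat -> 'cV[R]_n) l :
  dotv (u k - l) (u k - l) @[k --> \oo] --> (0 : R) ->
  u k @[k --> \oo] --> l.
Proof.
move=> ul; apply/cvg_mxP => i j; rewrite ord1.
apply/cvgrPdist_lt => e e0.
have e20 : 0 < e ^+ 2 by rewrite exprn_gt0.
have /cvgrPdist_lt/(_ _ e20) := ul.
apply: filterS => k; rewrite sub0r normrN ger0_norm ?dotv_ge0 // => uke.
rewrite -ltr_sqr ?nnegrE ?normr_ge0 ?(ltW e0) // (le_lt_trans _ uke) //.
rewrite real_normK ?num_real //.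
have := sqr_coord_le_dotv (u k - l) i.
by rewrite !mxE -sqrrN opprB.
Qed.

Lemma cvg_dotv_self0 n (u : nat -> 'cV[R]_n) :
  dotv (u k) (u k) @[k --> \oo] --> (0 : R) -> u k @[k --> \oo] --> (0 : 'cV[R]_n).
Proof. by move=> u0; apply: cvg_dotv0; under eq_fun do rewrite subr0. Qed.

Lemma cvg_usubmx m1 m2 p (u : nat -> 'M[R]_(m1 + m2, p))
    (l : 'M[R]_(m1 + m2, p)) :
  u k @[k --> \oo] --> l -> usubmx (u k) @[k --> \oo] --> usubmx l.
Proof.
move=> /cvg_mxP ul; apply/cvg_mxP => i j; rewrite mxE.
by under eq_fun do rewrite mxE; exact: ul.
Qed.

Lemma cvg_dsubmx m1 m2 p (u : nat -> 'M[R]_(m1 + m2, p))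
    (l : 'M[R]_(m1 + m2, p)) :
  u k @[k --> \oo] --> l -> dsubmx (u k) @[k --> \oo] --> dsubmx l.
Proof.
move=> /cvg_mxP ul; apply/cvg_mxP => i j; rewrite mxE.
by under eq_fun do rewrite mxE; exact: ul.
Qed.

Lemma cvg_col_mx m1 m2 p (u : nat -> 'M[R]_(m1, p)) (v : nat -> 'M[R]_(m2, p))
    (l : 'M[R]_(m1, p)) (l' : 'M[R]_(m2, p)) :
  u k @[k --> \oo] --> l -> v k @[k --> \oo] --> l' ->
  col_mx (u k) (v k) @[k --> \oo] --> col_mx l l'.
Proof.
move=> /cvg_mxP ul /cvg_mxP vl; apply/cvg_mxP => i j.
case: (split_ordP i) => h ->.
  by rewrite col_mxEu; under eq_fun do rewrite col_mxEu; exact: ul.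
by rewrite col_mxEd; under eq_fun do rewrite col_mxEd; exact: vl.
Qed.

Lemma increasing_seq_ge (phi : nat -> nat) :
  increasing_seq phi -> forall k, (k <= phi k)%N.
Proof.
move=> /increasing_seqP phiS; elim=> // k IH.
exact: leq_ltn_trans IH (phiS k).
Qed.

Lemma cvg_subseq (T : topologicalType) (u : nat -> T) (l : T) (phi : nat -> nat) :
  (forall k, (k <= phi k)%N) -> u k @[k --> \oo] --> l ->
  u (phi k) @[k --> \oo] --> l.
Proof.
move=> phik ul; apply: (cvg_comp phi u) ul.
move=> S [N _ NS]; exists N => // k /= Nk; apply: NS.
exact: leq_trans Nk (phik k).
Qed.

Lemma bolzano_weierstrass_cV n (u : nat -> 'cV[R]_n) (M : R) :
  (forall k, dotv (u k) (u k) <= M) ->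
  exists phi : nat -> nat, (forall k, (k <= phi k)%N) /\
    exists l : 'cV[R]_n, u (phi k) @[k --> \oo] --> l.
Proof.
move=> uM.
(* Induct over a list of coordinates, refining the subsequence once per coordinate. *)
suff [phi phik cvgu] : exists2 phi : nat -> nat, (forall k, (k <= phi k)%N) &
    forall i : 'I_n, i \in enum 'I_n ->
      exists l : R, u (phi k) i 0 @[k --> \oo] --> l.
  exists phi; split=> //.
  have /choice[l ul] : forall i : 'I_n, exists l : R,
      u (phi k) i 0 @[k --> \oo] --> l by move=> i; apply: cvgu; rewrite mem_enum.
  by exists (\col_i l i); apply/cvg_mxP => i j; rewrite ord1 mxE; exact: ul.
elim: (enum 'I_n) => [|i s [phi phik IH]]; first by exists id.
have [|psi psii /cvg_ex[/= l ul]] := @bolzano_weierstrass R (fun k => u (phi k) i 0).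
  exists (M + 1); split; first exact: num_real.
  move=> N MN k _; rewrite /= (le_trans _ (ltW MN)) //.
  have := le_trans (sqr_coord_le_dotv (u (phi k)) i) (uM _).
  rewrite -[X in X ^+ 2 <= _]/(u (phi k) i 0) -(real_normK (num_real _)) => h.
  (* A bound [M] on the square bounds the absolute value [a] by [M + 1], because
     [2 * a <= a ^+ 2 + 1]. *)
  have := sqr_ge0 (`|u (phi k) i 0| - 1); have := normr_ge0 (u (phi k) i 0).
  by move: h; set a := `|_|; nra.
have psik := increasing_seq_ge psii.
exists (phi \o psi) => [k|j]; first exact: leq_trans (psik k) (phik _).
rewrite inE => /orP[/eqP->|/IH[l' ul']]; first by exists l.
by exists l'; apply: (cvg_subseq psik ul').
Qed.

End MatrixConvergence.

(** * The two-block scheme as a pair of variational inequalities *)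

Section QuadraticForm.
Variables (R : realType) (m : nat) (H : 'M[R]_m).
Hypothesis H_sym : H^T = H.

Lemma dotv_sym (u v : 'cV[R]_m) : dotv u (H *m v) = dotv v (H *m u).
Proof. by rewrite dotvC -dotv_trmx H_sym. Qed.

Lemma qform_opp (u : 'cV[R]_m) : dotv (- u) (H *m (- u)) = dotv u (H *m u).
Proof. by rewrite mulmxN !dotv_bilin opprK. Qed.

(** Expansion of the form at (z - xp) + (xp - x). It turns the cross term of a proximal step into a
    telescoping difference minus the squared increment. *)
Lemma three_point (z xp x : 'cV[R]_m) :
  dotv (z - xp) (H *m (xp - x)) =
  (dotv (z - x) (H *m (z - x)) - dotv (z - xp) (H *m (z - xp))
   - dotv (x - xp) (H *m (x - xp))) / 2.
Proof.
have -> : z - x = (z - xp) + (xp - x) by rewrite addrA subrK.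
rewrite -[x - xp]opprB qform_opp; move: (z - xp) (xp - x) => e h.
by rewrite mulmxDr !dotv_bilin (dotv_sym h e); field.
Qed.

Lemma dotv_psd_le (u v : 'cV[R]_m) :
  0 <= dotv (u - v) (H *m (u - v)) ->
  dotv u (H *m v) <= (dotv u (H *m u) + dotv v (H *m v)) / 2.
Proof.
rewrite mulmxDr mulmxN !dotv_bilin (dotv_sym v u) => h.
by rewrite ler_pdivlMr //; lra.
Qed.

End QuadraticForm.

(** * Monotone and dominated real sequences *)

Section RealSequences.
Variable R : realType.

(** [u] is nonincreasing and bounded below, so [r] is squeezed between 0 and the vanishing
    differences of [u]. *)
Lemma decrease_cvg0 (u r : nat -> R) :
  (forall k, 0 <= u k) -> (forall k, 0 <= r k) ->
  (forall k, u k.+1 + r k <= u k) -> r k @[k --> \oo] --> (0 : R).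
Proof.
move=> u0 r0 ur.
have /cvg_ex[/= l ul] : cvgn u.
  apply: nonincreasing_is_cvgn.
    by apply/nonincreasing_seqP => k; rewrite (le_trans _ (ur k)) // lerDl.
  by exists 0 => _ [k _ <-].
apply: (@squeeze_cvgr _ _ _ _ (fun=> 0) (fun k => u k - u k.+1)).
- by near=> k; rewrite r0 /= lerBrDl.
- exact: cvg_cst.
- rewrite -(subrr l); apply: cvgB => //.
  exact: (cvg_subseq (phi := succn)).
Unshelve. all: by end_near. Qed.

Lemma dominated_cvg0 (u v : nat -> R) (C : R) :
  (forall k, 0 <= u k) -> (forall k, u k <= C * v k) ->
  v k @[k --> \oo] --> (0 : R) -> u k @[k --> \oo] --> (0 : R).
Proof.
move=> u0 uv v0.
apply: (@squeeze_cvgr _ _ _ _ (fun=> 0) (fun k => C * v k)).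
- by near=> k; rewrite u0 uv.
- exact: cvg_cst.
- by rewrite -(mulr0 C); apply: cvgMr.
Unshelve. all: by end_near. Qed.

Lemma nonincreasing_subseq_cvg0 (u : nat -> R) (phi : nat -> nat) :
  (forall k, 0 <= u k) -> (forall k, u k.+1 <= u k) ->
  u (phi k) @[k --> \oo] --> (0 : R) -> u k @[k --> \oo] --> (0 : R).
Proof.
move=> u0 ui uphi; apply/cvgrPdist_lt => e e0.
have /cvgrPdist_lt/(_ _ e0)[N _ /(_ N (leqnn _))] := uphi.
rewrite sub0r normrN ger0_norm // => uN.
have ui' : {homo u : i j / (i <= j)%N >-> j <= i} by apply/nonincreasing_seqP.
exists (phi N) => // k /= Nk.
by rewrite sub0r normrN ger0_norm // (le_lt_trans (ui' _ _ Nk)).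
Qed.

End RealSequences.

Definition seq_closed (R : realType) p (D : set 'cV[R]_p) : Prop :=
  forall (u : nat -> 'cV[R]_p) (l : 'cV[R]_p),
  (forall k, D (u k)) -> u k @[k --> \oo] --> l -> D l.

(** Sequential closedness of the epigraph: a convergent bound [r] replaces a lower limit of [F]. *)
Definition seq_lsc (R : realType) p (F : 'cV[R]_p -> R) : Prop :=
  forall (u : nat -> 'cV[R]_p) (l : 'cV[R]_p) (r : nat -> R) (t : R),
  u k @[k --> \oo] --> l -> r k @[k --> \oo] --> t ->
  (forall k, F (u k) <= r k) -> F l <= t.

Section TwoBlockADMM.
Variables (R : realType) (n m d : nat).
Variables (A : 'M[R]_(n, m)) (B : 'M[R]_(n, d)) (c : 'cV[R]_n).
Variables (f : 'cV[R]_m -> R) (g : 'cV[R]_d -> R).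
Variables (X : set 'cV[R]_m) (Y : set 'cV[R]_d).
Variables (Hx : 'M[R]_m) (Hy : 'M[R]_d) (beta tau s : R).

Local Notation res x y := (A *m x + B *m y - c).

(** First-order optimality of [xp] for minimizing F(z) - <mu, M z> + |z - x|_H^2 / 2 over [D],
    written without derivatives of [F]. *)
Definition prox_vi k (F : 'cV[R]_k -> R) (D : set 'cV[R]_k) (M : 'M[R]_(n, k))
    (H : 'M[R]_k) (x xp : 'cV[R]_k) (mu : 'cV[R]_n) : Prop :=
  D xp /\ forall z, D z ->
  F xp - F z <= - dotv (M *m (z - xp)) mu + dotv (z - xp) (H *m (xp - x)).

(** Both multipliers contain the residual after the sweep, not before it; the correction for blocks
    updated in parallel sits in [Hx] and [Hy]. *)
Definition admm_vi (x : nat -> 'cV[R]_m) (y : nat -> 'cV[R]_d)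
    (lam lamh : nat -> 'cV[R]_n) : Prop :=
  forall k,
  [/\ prox_vi f X A Hx (x k) (x k.+1) (lam k - beta *: res (x k.+1) (y k)),
      lamh k = lam k - (tau * beta) *: res (x k.+1) (y k),
      prox_vi g Y B Hy (y k) (y k.+1) (lamh k - beta *: res (x k.+1) (y k.+1)) &
      lam k.+1 = lamh k - (s * beta) *: res (x k.+1) (y k.+1)].

(* h(u') - h(u) + <w' - w, J(w)> for w' = (x', y', l') and w = (x, y, l) *)
Definition gap (x' : 'cV[R]_m) (y' : 'cV[R]_d) (l' : 'cV[R]_n)
    (x : 'cV[R]_m) (y : 'cV[R]_d) (l : 'cV[R]_n) : R :=
  f x' + g y' - f x - g y - dotv (A *m (x' - x) + B *m (y' - y)) l
  + dotv (l' - l) (res x y).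

Definition saddle (x : 'cV[R]_m) (y : 'cV[R]_d) (l : 'cV[R]_n) : Prop :=
  [/\ X x, Y y & forall x' y' l', X x' -> Y y' -> 0 <= gap x' y' l' x y l].

(* The quadratic form of the matrix H of the paper, completed to squares so
   that its nonnegativity for tau <= 1 is visible. *)
Definition lyap (x : 'cV[R]_m) (y : 'cV[R]_d) (l : 'cV[R]_n) : R :=
  dotv x (Hx *m x) + dotv y (Hy *m y) + beta * (1 - tau) * dotv (B *m y) (B *m y)
  + (beta * (tau + s))^-1 *
    dotv (l - (tau * beta) *: (B *m y)) (l - (tau * beta) *: (B *m y)).

Hypothesis Hx_sym : Hx^T = Hx.
Hypothesis Hy_sym : Hy^T = Hy.
Hypothesis Hx_psd : forall v, 0 <= dotv v (Hx *m v).
Hypothesis Hy_psd : forall v, 0 <= dotv v (Hy *m v).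
Hypothesis beta_gt0 : 0 < beta.
Hypothesis taus_gt0 : 0 < tau + s.
Hypothesis tau_le1 : tau <= 1.
Hypothesis dom_gt0 : 0 < - tau ^+ 2 - s ^+ 2 - tau * s + tau + s + 1.

(** * One-step estimates and the decrease of the merit function *)

Lemma onetau_gt0 : 0 < 1 + tau.
Proof.
(* the domain condition, solved as a quadratic in s, has a nonnegative discriminant *)
have : 0 < (5 - 3 * tau) * (1 + tau).
  have -> : (5 - 3 * tau) * (1 + tau) =
      4 * (- tau ^+ 2 - s ^+ 2 - tau * s + tau + s + 1) + (2 * s + tau - 1) ^+ 2.
    by ring.
  by rewrite ltr_wpDr ?sqr_ge0 ?mulr_gt0.
by rewrite pmulr_rgt0 //; have := tau_le1; lra.
Qed.

Lemma lyap_ge0 x y l : 0 <= lyap x y l.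
Proof.
rewrite /lyap !addr_ge0 ?mulr_ge0 ?dotv_ge0 ?Hx_psd ?Hy_psd ?invr_ge0 //.
- exact: ltW.
- by rewrite subr_ge0.
- by rewrite ltW ?mulr_gt0.
Qed.

(** The part of the one-step estimate free of [f], [g], [Hx], [Hy], as an identity between
    independent vectors. Here [e] stands for the residual at the comparison point, [r] for the new
    residual, [v] for B (y^k - y^(k+1)), [p] for B (w - y^(k+1)) and [L] for l - lambda^k. *)
Lemma step_identity (e r v p L lk : 'cV[R]_n) :
  let lt := lk - beta *: (r + v) in
  let mu := lk - (tau * beta) *: (r + v) - beta *: r in
  - dotv (e - r - p) lt - dotv p mu - dotv (r - e) (L + lk)
    + dotv (lt - (L + lk)) e =
  (beta * (1 - tau) * (dotv (p - v) (p - v) - dotv p p) +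
   (beta * (tau + s))^-1 *
    (dotv (L - (tau * beta) *: (p - v)) (L - (tau * beta) *: (p - v)) -
     dotv (L + (tau * beta) *: (r + v) + (s * beta) *: r - (tau * beta) *: p)
          (L + (tau * beta) *: (r + v) + (s * beta) *: r - (tau * beta) *: p)))
   / 2
  - beta * ((1 - tau) * dotv v v + 2 * (1 - tau) * dotv v r
            + (2 - tau - s) * dotv r r) / 2.
Proof.
move=> lt mu; rewrite /lt /mu !dotv_bilin.
(* Orient every inner product one way, so that [field] sees each pair as a single atom. *)
rewrite ?(dotvC r e) ?(dotvC v e) ?(dotvC p e) ?(dotvC L e) ?(dotvC lk e).
rewrite ?(dotvC v r) ?(dotvC p r) ?(dotvC L r) ?(dotvC lk r).
rewrite ?(dotvC p v) ?(dotvC L v) ?(dotvC lk v) ?(dotvC L p) ?(dotvC lk p).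
rewrite ?(dotvC lk L).
by field; rewrite !gt_eqF.
Qed.

Section Iterates.
Variables (x : nat -> 'cV[R]_m) (y : nat -> 'cV[R]_d).
Variables (lam lamh : nat -> 'cV[R]_n).
Hypothesis vi : admm_vi x y lam lamh.

Local Notation ltilde k := (lam k - beta *: res (x k.+1) (y k)).
Local Notation r_ k := (res (x k) (y k)).
Local Notation d_ k := (B *m (y k - y k.+1)).
Local Notation qx k := (dotv (x k - x k.+1) (Hx *m (x k - x k.+1))).
Local Notation qy k := (dotv (y k - y k.+1) (Hy *m (y k - y k.+1))).

Lemma res_shift k : res (x k.+1) (y k) = r_ k.+1 + d_ k.
Proof.
by rewrite mulmxBr; apply/matrixP => i j; rewrite !mxE; ring.
Qed.

Lemma lam_shift k : lam k.+1 =
  lam k - (tau * beta) *: (r_ k.+1 + d_ k) - (s * beta) *: r_ k.+1.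
Proof. by have [_ lh _ ->] := vi k; rewrite lh res_shift. Qed.

(** Add the two proximal inequalities: [three_point] makes the [Hx] and [Hy] terms telescope, and
    [step_identity] does so for the remaining ones. *)
Lemma gap_step k z w l : X z -> Y w ->
  gap (x k.+1) (y k.+1) (ltilde k) z w l <=
  (lyap (z - x k) (w - y k) (l - lam k)
   - lyap (z - x k.+1) (w - y k.+1) (l - lam k.+1)) / 2
  - (qx k + qy k + beta * ((1 - tau) * dotv (d_ k) (d_ k)
     + 2 * (1 - tau) * dotv (d_ k) (r_ k.+1)
     + (2 - tau - s) * dotv (r_ k.+1) (r_ k.+1))) / 2.
Proof.
move=> Xz Yw; have [[_ hx] lh [_ hy] lS] := vi k; move: (hx z Xz) (hy w Yw) => {}hx {}hy.
rewrite !three_point // in hx hy.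
set r := r_ k.+1; set v := d_ k; set e := res z w.
set p := B *m (w - y k.+1); set L := l - lam k.
have /= := step_identity e r v p L (lam k).
have rs : res (x k.+1) (y k) = r + v by rewrite res_shift.
have -> : e - r - p = A *m (z - x k.+1).
  by rewrite /e /r /p !mulmxBr; apply/matrixP => i j; rewrite !mxE; ring.
have -> : r - e = A *m (x k.+1 - z) + B *m (y k.+1 - w).
  by rewrite /e /r !mulmxBr; apply/matrixP => i j; rewrite !mxE; ring.
have -> : L + lam k = l by rewrite /L subrK.
have -> : p - v = B *m (w - y k).
  by rewrite /p /v !mulmxBr; apply/matrixP => i j; rewrite !mxE; ring.
have -> : L + (tau * beta) *: (r + v) + (s * beta) *: r = l - lam k.+1.
  by rewrite lam_shift -/r -/v /L; apply/matrixP => i j; rewrite !mxE; ring.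
move=> E; rewrite /gap /lyap -/e -/p -/L.
move: hx hy; rewrite lh rs -/r -/p => hx hy.
lra.
Qed.

(* Optimality of y^(k+1) tested at y^(k+2), plus optimality of y^(k+2) tested at
   y^(k+1). *)
Lemma cross_term k :
  (qy k.+1 - qy k) / 2 <=
  beta * ((1 + tau) * dotv (d_ k.+1) (r_ k.+2)
    + tau * dotv (d_ k.+1) (d_ k.+1) - (1 - s) * dotv (d_ k.+1) (r_ k.+1)).
Proof.
have [_ lh1 [Y1 h1] l1] := vi k.
have [_ lh2 [Y2 h2] l2] := vi k.+1.
have {h1} := h1 _ Y2; have {h2} := h2 _ Y1.
rewrite lh2 l1 res_shift.
set mu := lamh k; set r1 := r_ k.+1; set r2 := r_ k.+2.
have -> : B *m (y k.+2 - y k.+1) = - d_ k.+1 by rewrite -mulmxN opprB.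
rewrite -[y k.+2 - y k.+1]opprB -[y k.+1 - y k]opprB.
set v := d_ k.+1.
clearbody v r1 r2 mu; move: (y k.+1 - y k.+2) (y k - y k.+1) => a b.
(* Young's inequality for the product of successive y-increments in the [Hy] form; it leaves half
   the difference of their squares. *)
have := dotv_psd_le Hy_sym (Hy_psd (a - b)).
rewrite !mulmxN !dotv_bilin !opprK => h0 h2 h1.
lra.
Qed.

(** These coefficients arise when the cross term is replaced through [cross_term], the rest is
    completed to the square of (1 - tau) d + (1 - s) r, and the result is divided by 1 + tau. The
    numerator of [kappa] contains the polynomial defining the domain. *)
Definition xi3 : R := beta * (1 - s) ^+ 2 / (1 + tau).
Definition xi4 : R := (1 - tau) / (1 + tau).
Definition kappa : R :=
  beta * (- tau ^+ 2 - s ^+ 2 - tau * s + tau + s + 1) / (1 + tau).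

Lemma xi3_ge0 : 0 <= xi3.
Proof.
by rewrite divr_ge0 ?(ltW onetau_gt0) // mulr_ge0 ?sqr_ge0 ?(ltW beta_gt0).
Qed.

Lemma xi4_ge0 : 0 <= xi4.
Proof. by rewrite divr_ge0 ?subr_ge0 ?(ltW onetau_gt0). Qed.

Lemma kappa_gt0 : 0 < kappa.
Proof. by rewrite /kappa divr_gt0 ?mulr_gt0 ?onetau_gt0. Qed.

(** [lyap] augmented by the two quantities that [cross_term] carries over from the previous step.
    The y-increment is zero at index 0; the decrease is stated from index 1 on, where a previous
    y-sweep exists. *)
Definition merit k (z : 'cV[R]_m) (w : 'cV[R]_d) (l : 'cV[R]_n) : R :=
  lyap (z - x k) (w - y k) (l - lam k) + xi3 * dotv (r_ k) (r_ k)
  + xi4 * dotv (y k - y k.-1) (Hy *m (y k - y k.-1)).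

Lemma merit_ge0 k z w l : 0 <= merit k z w l.
Proof.
apply: addr_ge0; first apply: addr_ge0; first exact: lyap_ge0.
  by rewrite mulr_ge0 ?xi3_ge0 ?dotv_ge0.
by rewrite mulr_ge0 ?xi4_ge0 ?Hy_psd.
Qed.

(** [gap_step] for the second of two consecutive steps, plus [cross_term] with weight 2 (1 - tau) /
    (1 + tau), which is nonnegative because tau <= 1. *)
Lemma gap_merit k z w l : X z -> Y w ->
  2 * gap (x k.+2) (y k.+2) (ltilde k.+1) z w l
  + (qx k.+1 + qy k.+1 + kappa * dotv (r_ k.+2) (r_ k.+2)) <=
  merit k.+1 z w l - merit k.+2 z w l.
Proof.
move=> Xz Yw; have := gap_step k.+1 l Xz Yw; have := cross_term k.
(* the square absorbing the term in <d, r> left by [cross_term] *)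
have : 0 <= (1 - tau) ^+ 2 * dotv (d_ k.+1) (d_ k.+1)
    + 2 * (1 - tau) * (1 - s) * dotv (d_ k.+1) (r_ k.+1)
    + (1 - s) ^+ 2 * dotv (r_ k.+1) (r_ k.+1).
  have := dotv_ge0 ((1 - tau) *: d_ k.+1 + (1 - s) *: r_ k.+1).
  move: (d_ k.+1) (r_ k.+1) => v r.
  by rewrite !dotv_bilin (dotvC r v); lra.
have qyN j : dotv (y j.+1 - y j) (Hy *m (y j.+1 - y j)) = qy j.
  by rewrite -opprB qform_opp.
rewrite /merit /= !qyN.
set v := d_ k.+1; set r1 := r_ k.+1; set r2 := r_ k.+2.
set G := gap _ _ _ _ _ _; set P1 := lyap _ _ _; set P2 := lyap _ _ _.
set q2 := qy k.+1; set q1 := qy k; set qq := qx k.+1.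
set vv := dotv v v; set vr1 := dotv v r1; set vr2 := dotv v r2.
set rr1 := dotv r1 r1; set rr2 := dotv r2 r2.
move=> hC hcross hgap.
have t1 := onetau_gt0.
(* The surplus is a nonnegative combination: the square above plus 2 (1 - tau) / beta times the
   slack of [cross_term], all over 1 + tau. *)
have E : (1 - tau) * vv + 2 * (1 - tau) * vr2 + (2 - tau - s) * rr2
   - (1 - tau) * (q2 - q1) / (1 + tau) / beta
   - ((1 - s) ^+ 2 * (rr2 - rr1) +
     (- tau ^+ 2 - s ^+ 2 - tau * s + tau + s + 1) * rr2) / (1 + tau) =
   ((1 - tau) * ((1 - tau) * vv + (1 - s) * vr1) +
    (1 - s) * ((1 - tau) * vr1 + (1 - s) * rr1)
    + 2 * (1 - tau) / beta *
      (beta * ((1 + tau) * vr2 + tau * vv - (1 - s) * vr1) - (q2 - q1) / 2))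
   / (1 + tau).
  by field; rewrite !gt_eqF.
have : 0 <= ((1 - tau) * ((1 - tau) * vv + (1 - s) * vr1) +
    (1 - s) * ((1 - tau) * vr1 + (1 - s) * rr1)
    + 2 * (1 - tau) / beta *
      (beta * ((1 + tau) * vr2 + tau * vv - (1 - s) * vr1) - (q2 - q1) / 2))
   / (1 + tau).
  apply: divr_ge0; last exact: ltW.
  apply: addr_ge0; first lra.
  apply: mulr_ge0; last by rewrite subr_ge0.
  by rewrite divr_ge0 ?(ltW beta_gt0) // mulr_ge0 // subr_ge0.
rewrite -E => /(mulr_ge0 (ltW beta_gt0)).
have -> : beta * ((1 - tau) * vv + 2 * (1 - tau) * vr2 + (2 - tau - s) * rr2
   - (1 - tau) * (q2 - q1) / (1 + tau) / beta
   - ((1 - s) ^+ 2 * (rr2 - rr1) +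
     (- tau ^+ 2 - s ^+ 2 - tau * s + tau + s + 1) * rr2) / (1 + tau)) =
   beta * ((1 - tau) * vv + 2 * (1 - tau) * vr2 + (2 - tau - s) * rr2)
   - xi4 * (q2 - q1) - xi3 * (rr2 - rr1) - kappa * rr2.
  by rewrite /xi3 /xi4 /kappa; field; rewrite !gt_eqF.
lra.
Qed.

(** [gap_merit] telescopes, and its nonnegative decrements and the final merit are dropped. The sum
    starts at 1 since each term needs an earlier y-sweep. *)
Lemma sum_gap_le t z w l : X z -> Y w ->
  \sum_(1 <= k < t.+1) gap (x k.+1) (y k.+1) (ltilde k) z w l
  <= merit 1 z w l / 2.
Proof.
move=> Xz Yw.
suff : \sum_(1 <= k < t.+1) gap (x k.+1) (y k.+1) (ltilde k) z w l
  <= (merit 1 z w l - merit t.+1 z w l) / 2.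
  by have := merit_ge0 t.+1 z w l; lra.
elim: t => [|t IH]; first by rewrite big_geq // subrr mul0r.
rewrite big_nat_recr //=.
have := gap_merit t l Xz Yw.
have := Hx_psd (x t.+1 - x t.+2); have := Hy_psd (y t.+1 - y t.+2).
have := mulr_ge0 (ltW kappa_gt0) (dotv_ge0 (r_ t.+2)).
lra.
Qed.

(** * Convergence of the iterates for coercive proximal matrices *)

Section Convergence.
Variables cx cy : R.
Hypothesis cx_gt0 : 0 < cx.
Hypothesis cy_gt0 : 0 < cy.
Hypothesis Hx_coercive : forall v, cx * dotv v v <= dotv v (Hx *m v).
Hypothesis Hy_coercive : forall v, cy * dotv v v <= dotv v (Hy *m v).
Hypothesis X_closed : seq_closed X.
Hypothesis Y_closed : seq_closed Y.
Hypothesis f_lsc : seq_lsc f.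
Hypothesis g_lsc : seq_lsc g.

(** Coercivity of [Hx] and [Hy] controls [z] and [w]. Then [l] is recovered from the completed
    square, at the cost of a multiple of |B w|^2, itself bounded by |w|^2. *)
Lemma lyap_coercive : exists2 C, 0 <= C & forall z w l,
  dotv z z + (dotv w w + dotv l l) <= C * lyap z w l.
Proof.
have [CB CB0 hCB] := dotv_mulmx_bound B.
have bts : 0 < beta * (tau + s) by rewrite mulr_gt0.
have cx0 := cx_gt0; have cy0 := cy_gt0.
have K0 : 0 <= 2 * (tau * beta) ^+ 2 * CB by rewrite mulr_ge0 // mulr_ge0 // sqr_ge0.
(* The summands bound, in order, |z|^2, |w|^2, and the two terms in the splitting of |l|^2. *)
exists (cx^-1 + cy^-1 + 2 * (beta * (tau + s))
        + 2 * (tau * beta) ^+ 2 * CB * cy^-1).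
  have cxV : 0 <= cx^-1 by rewrite invr_ge0 ltW.
  have cyV : 0 <= cy^-1 by rewrite invr_ge0 ltW.
  by have := mulr_ge0 K0 cyV; lra.
move=> z w l.
have hx := Hx_coercive z; have hy := Hy_coercive w.
have qx0 := Hx_psd z; have qy0 := Hy_psd w.
have hb := dotv_ge0 (B *m w).
have h1t : 0 <= beta * (1 - tau) * dotv (B *m w) (B *m w).
  by rewrite !mulr_ge0 ?subr_ge0 // ltW.
have hv := dotv_ge0 (l - (tau * beta) *: (B *m w)).
have hl : dotv l l <= 2 * dotv (l - (tau * beta) *: (B *m w))
    (l - (tau * beta) *: (B *m w)) + 2 * (tau * beta) ^+ 2 * dotv (B *m w) (B *m w).
  have := dotv_ge0 (l - (tau * beta) *: (B *m w) - (tau * beta) *: (B *m w)).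
  move: (B *m w) => b.
  by rewrite !dotv_bilin (dotvC b l); lra.
have hv' : 0 <= (beta * (tau + s))^-1 * dotv (l - (tau * beta) *: (B *m w))
    (l - (tau * beta) *: (B *m w)) by rewrite mulr_ge0 // invr_ge0 ltW.
have hBw := hCB w.
have l1 : dotv z z <= cx^-1 * lyap z w l.
  by rewrite ler_pdivlMl // (le_trans hx) // /lyap; lra.
have l2 : dotv w w <= cy^-1 * lyap z w l.
  by rewrite ler_pdivlMl // (le_trans hy) // /lyap; lra.
have l3 : dotv (l - (tau * beta) *: (B *m w)) (l - (tau * beta) *: (B *m w))
    <= beta * (tau + s) * lyap z w l.
  by rewrite -ler_pdivrMl // /lyap; lra.
have l4 : 2 * (tau * beta) ^+ 2 * dotv (B *m w) (B *m w) <=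
    2 * (tau * beta) ^+ 2 * CB * (cy^-1 * lyap z w l).
  rewrite -!(mulrA 2) ler_pM2l // -mulrA ler_wpM2l ?sqr_ge0 //.
  by rewrite (le_trans hBw) // ler_wpM2l.
lra.
Qed.

Lemma cvg_lyap (u : nat -> 'cV[R]_m) (v : nat -> 'cV[R]_d)
    (w : nat -> 'cV[R]_n) (a : 'cV[R]_m) (b : 'cV[R]_d) (e : 'cV[R]_n) :
  u k @[k --> \oo] --> a -> v k @[k --> \oo] --> b -> w k @[k --> \oo] --> e ->
  lyap (u k) (v k) (w k) @[k --> \oo] --> lyap a b e.
Proof.
move=> ua vb we; have Bv := cvg_mulmx (M := B) vb.
have wBv : w k - (tau * beta) *: (B *m v k) @[k --> \oo] -->
    e - (tau * beta) *: (B *m b) by apply: cvgB => //; exact: cvgZr.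
apply: cvgD; [apply: cvgD; [apply: cvgD|]|].
- by apply: cvg_dotv => //; exact: cvg_mulmx.
- by apply: cvg_dotv => //; exact: cvg_mulmx.
- by apply: cvgMr; exact: cvg_dotv.
- by apply: cvgMr; exact: cvg_dotv.
Qed.

Lemma decrement_ge0 j k : 0 <= qx j + qy j + kappa * dotv (r_ k) (r_ k).
Proof.
apply: addr_ge0; first by apply: addr_ge0; [exact: Hx_psd|exact: Hy_psd].
by apply: mulr_ge0; [exact: ltW kappa_gt0|exact: dotv_ge0].
Qed.

Lemma merit_decrease k z w l : saddle z w l ->
  merit k.+2 z w l + (qx k.+1 + qy k.+1 + kappa * dotv (r_ k.+2) (r_ k.+2))
  <= merit k.+1 z w l.
Proof.
move=> [Xz Yw sad]; have := gap_merit k l Xz Yw.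
have [[X2 _] _ [Y2 _] _] := vi k.+1.
have := sad _ _ (ltilde k.+1) X2 Y2.
lra.
Qed.

Section WithSaddle.
Variables (z0 : 'cV[R]_m) (w0 : 'cV[R]_d) (l0 : 'cV[R]_n).
Hypothesis saddle0 : saddle z0 w0 l0.

(** The decrements of the merit function vanish, and coercivity together with [kappa] > 0 lets them
    dominate all three squared norms. *)
Lemma increments_cvg0 :
  [/\ x k.+1 - x k.+2 @[k --> \oo] --> (0 : 'cV[R]_m),
      y k.+1 - y k.+2 @[k --> \oo] --> (0 : 'cV[R]_d) &
      r_ k.+2 @[k --> \oo] --> (0 : 'cV[R]_n)].
Proof.
have k0 := kappa_gt0.
have q0 k : 0 <= qx k by [].
have p0 k : 0 <= qy k by [].
have r0 k : 0 <= kappa * dotv (r_ k) (r_ k) by rewrite mulr_ge0 ?dotv_ge0 // ltW.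
have rho0 : qx k.+1 + qy k.+1 + kappa * dotv (r_ k.+2) (r_ k.+2)
    @[k --> \oo] --> (0 : R).
  apply: (@decrease_cvg0 _ (fun k => merit k.+1 z0 w0 l0)).
  - by move=> k; exact: merit_ge0.
  - by move=> k; exact: decrement_ge0.
  - by move=> k; exact: merit_decrease.
split; apply: cvg_dotv_self0.
- apply: (dominated_cvg0 (C := cx^-1)) rho0 => k; first exact: dotv_ge0.
  rewrite ler_pdivlMl // (le_trans (Hx_coercive _)) //.
  by have := p0 k.+1; have := r0 k.+2; lra.
- apply: (dominated_cvg0 (C := cy^-1)) rho0 => k; first exact: dotv_ge0.
  rewrite ler_pdivlMl // (le_trans (Hy_coercive _)) //.
  by have := q0 k.+1; have := r0 k.+2; lra.
- apply: (dominated_cvg0 (C := kappa^-1)) rho0 => k; first exact: dotv_ge0.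
  by rewrite ler_pdivlMl //; have := q0 k.+1; have := p0 k.+1; lra.
Qed.

Lemma cluster_point : exists phi : nat -> nat, (forall k, (k <= phi k)%N) /\
  exists xi yi li, [/\ x (phi k).+1 @[k --> \oo] --> (xi : 'cV[R]_m),
    y (phi k).+1 @[k --> \oo] --> (yi : 'cV[R]_d) &
    lam (phi k).+1 @[k --> \oo] --> (li : 'cV[R]_n)].
Proof.
have [C C0 hC] := lyap_coercive.
(* The three errors are stacked so that one subsequence serves them all. *)
pose u k := col_mx (z0 - x k.+1) (col_mx (w0 - y k.+1) (l0 - lam k.+1)).
have [k|phi [phik [l ul]]] := @bolzano_weierstrass_cV R _ u (C * merit 1 z0 w0 l0).
  rewrite /u !dotv_col_mx (le_trans (hC _ _ _)) // ler_wpM2l //.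
  apply: (@le_trans _ _ (merit k.+1 z0 w0 l0)).
    by rewrite /merit -addrA lerDl addr_ge0 // mulr_ge0 ?dotv_ge0 ?xi3_ge0 ?xi4_ge0.
  elim: k => // k; apply: le_trans.
  apply: le_trans (merit_decrease _ saddle0).
  by rewrite lerDl; exact: decrement_ge0.
exists phi; split => //.
have sub_cvg p (v : nat -> 'cV[R]_p) (a b : 'cV[R]_p) :
    a - v k @[k --> \oo] --> b -> v k @[k --> \oo] --> a - b.
  move=> vb; have -> : v = (fun k => a - (a - v k)).
    by apply/funext => k; rewrite subKr.
  by apply: cvgB => //; exact: cvg_cst.
exists (z0 - usubmx l), (w0 - usubmx (dsubmx l)), (l0 - dsubmx (dsubmx l)).
split; apply: sub_cvg.
- have := cvg_usubmx ul; rewrite /u.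
  by under eq_fun do rewrite col_mxKu.
- have := cvg_usubmx (cvg_dsubmx ul); rewrite /u.
  by under eq_fun do rewrite col_mxKd col_mxKu.
- have := cvg_dsubmx (cvg_dsubmx ul); rewrite /u.
  by under eq_fun do rewrite !col_mxKd.
Qed.

Lemma cvg_res (u : nat -> 'cV[R]_m) (v : nat -> 'cV[R]_d) (a : 'cV[R]_m) (b : 'cV[R]_d) :
  u k @[k --> \oo] --> a -> v k @[k --> \oo] --> b ->
  res (u k) (v k) @[k --> \oo] --> res a b.
Proof.
move=> ua vb; apply: cvgB; last exact: cvg_cst.
by apply: cvgD; exact: cvg_mulmx.
Qed.

(** Both [u] and [u'] tend to [v], so the proximal term vanishes in the limit; lower semicontinuity
    handles [F]. *)
Lemma prox_vi_limit p (F : 'cV[R]_p -> R) D (M : 'M[R]_(n, p)) H u u' mu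
    (v : 'cV[R]_p) (e : 'cV[R]_n) :
  seq_closed D -> seq_lsc F ->
  (forall k, prox_vi F D M H (u k) (u' k) (mu k)) ->
  u k @[k --> \oo] --> v -> u' k @[k --> \oo] --> v -> mu k @[k --> \oo] --> e ->
  D v /\ forall z, D z -> F v - F z <= - dotv (M *m (z - v)) e.
Proof.
move=> Dc Fl hvi uv u'v mue; split.
  by apply: Dc u'v => k; have [] := hvi k.
move=> z Dz; rewrite lerBlDr.
have zu' : z - u' k @[k --> \oo] --> z - v by apply: cvgB => //; exact: cvg_cst.
have -> : - dotv (M *m (z - v)) e + F z =
    - dotv (M *m (z - v)) e + dotv (z - v) (H *m (v - v)) + F z.
  by rewrite subrr mulmx0 dotv0r addr0.
apply: (Fl u' v (fun k => - dotv (M *m (z - u' k)) (mu k)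
  + dotv (z - u' k) (H *m (u' k - u k)) + F z)) => //.
- apply: cvgD; last exact: cvg_cst.
  apply: cvgD; first by apply: cvgN; apply: cvg_dotv => //; exact: cvg_mulmx.
  by apply: cvg_dotv => //; apply: cvg_mulmx; exact: cvgB.
- by move=> k; rewrite -lerBlDr; have [_ ->] := hvi k.
Qed.

(* The merit function is nonincreasing at every saddle point, hence also at the
   limit of a subsequence, where it must then tend to 0. *)
Lemma admm_converges : exists xi yi li,
  [/\ saddle xi yi li, res xi yi = 0, x k @[k --> \oo] --> xi,
      y k @[k --> \oo] --> yi & lam k @[k --> \oo] --> li].
Proof.
have [dx0 dy0 r0] := increments_cvg0.
have [phi [phik [xi [yi [li [x1 y1 l1]]]]]] := cluster_point.
have {}dx0 := cvg_subseq phik dx0; have {}dy0 := cvg_subseq phik dy0.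
have {}r0 := cvg_subseq phik r0.
(* A step links two consecutive indices, so the successors of the subsequence must converge to the
   same point. *)
have next p (u : nat -> 'cV[R]_p) (v : 'cV[R]_p) : u (phi k).+1 @[k --> \oo] --> v ->
    u (phi k).+1 - u (phi k).+2 @[k --> \oo] --> (0 : 'cV[R]_p) ->
    u (phi k).+2 @[k --> \oo] --> v.
  move=> u1 du; have -> : (fun k => u (phi k).+2) =
      (fun k => u (phi k).+1 - (u (phi k).+1 - u (phi k).+2)).
    by apply/funext => k; rewrite subKr.
  by rewrite -[v]subr0; exact: cvgB.
have x2 := next _ _ _ x1 dx0; have y2 := next _ _ _ y1 dy0.
have res0 : res xi yi = 0.
  exact: (cvg_unique (@norm_hausdorff _ _) (cvg_res x2 y2) r0).
have r21 := cvg_res x2 y1; rewrite res0 in r21.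
have scale0 a (v : nat -> 'cV[R]_n) : v k @[k --> \oo] --> (0 : 'cV[R]_n) ->
    a *: v k @[k --> \oo] --> (0 : 'cV[R]_n).
  by move=> v0; rewrite -(scaler0 _ a); exact: cvgZr.
(* All multipliers around the subsequence differ by multiples of vanishing residuals, hence share
   the limit [li]. *)
have mu1 : lam (phi k).+1 - beta *: res (x (phi k).+2) (y (phi k).+1)
    @[k --> \oo] --> li.
  by rewrite -[li]subr0; apply: cvgB => //; exact: scale0.
have lh1 : lamh (phi k).+1 @[k --> \oo] --> li.
  have -> : (fun k => lamh (phi k).+1) = (fun k => lam (phi k).+1 -
      (tau * beta) *: res (x (phi k).+2) (y (phi k).+1)).
    by apply/funext => k; have [_ ->] := vi (phi k).+1.
  by rewrite -[li]subr0; apply: cvgB => //; exact: scale0.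
have mu2 : lamh (phi k).+1 - beta *: r_ (phi k).+2 @[k --> \oo] --> li.
  by rewrite -[li]subr0; apply: cvgB => //; exact: scale0.
have l2 : lam (phi k).+2 @[k --> \oo] --> li.
  have -> : (fun k => lam (phi k).+2) = (fun k => lamh (phi k).+1 -
      (s * beta) *: r_ (phi k).+2).
    by apply/funext => k; have [_ _ _ ->] := vi (phi k).+1.
  by rewrite -[li]subr0; apply: cvgB => //; exact: scale0.
have [Xxi hx] : X xi /\ forall z, X z -> f xi - f z <= - dotv (A *m (z - xi)) li.
  apply: (prox_vi_limit X_closed f_lsc _ x1 x2 mu1).
  by move=> k; have [h _ _ _] := vi (phi k).+1; exact: h.
have [Yyi hy] : Y yi /\ forall z, Y z -> g yi - g z <= - dotv (B *m (z - yi)) li.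
  apply: (prox_vi_limit Y_closed g_lsc _ y1 y2 mu2).
  by move=> k; have [_ _ h _] := vi (phi k).+1; exact: h.
have sad : saddle xi yi li.
  (* Since the residual is zero at the limit, the gap no longer depends on [l'] and is the sum of
     the two inequalities. *)
  split=> // x' y' l' Xx' Yy'; rewrite /gap res0 dotv0r dotvDl.
  by have := hx _ Xx'; have := hy _ Yy'; lra.
have const_sub p (u : nat -> 'cV[R]_p) (v : 'cV[R]_p) : u k @[k --> \oo] --> v ->
    v - u k @[k --> \oo] --> (0 : 'cV[R]_p).
  by move=> uv; rewrite -(subrr v); apply: cvgB => //; exact: cvg_cst.
have dsq0 p (H : 'M[R]_p) (u : nat -> 'cV[R]_p) :
    u k @[k --> \oo] --> (0 : 'cV[R]_p) ->
    dotv (u k) (H *m u k) @[k --> \oo] --> (0 : R).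
  by move=> u0; rewrite -(dotv0l (H *m 0)); apply: cvg_dotv => //; exact: cvg_mulmx.
have merit0 : merit k.+1 xi yi li @[k --> \oo] --> (0 : R).
  apply: (@nonincreasing_subseq_cvg0 _ _ (fun k => (phi k).+1)).
  - by move=> k; exact: merit_ge0.
  - move=> k; apply: le_trans (merit_decrease _ sad).
    by rewrite lerDl; exact: decrement_ge0.
  - rewrite /merit /=.
    have lyap000 : lyap 0 0 0 = 0.
      by rewrite /lyap !mulmx0 scaler0 subr0 !dotv0l !mulr0 !addr0.
    rewrite -[0]addr0; apply: cvgD; first (rewrite -[0]addr0; apply: cvgD).
    + by rewrite -lyap000; apply: cvg_lyap; exact: const_sub.
    + rewrite -(mulr0 xi3); apply: cvgMr.
      by rewrite -(dotv0l (0 : 'cV[R]_n)); exact: cvg_dotv.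
    + rewrite -(mulr0 xi4); apply: cvgMr; apply: dsq0.
      rewrite -oppr0; under eq_fun do rewrite -opprB.
      exact: cvgN.
have [C C0 hC] := lyap_coercive.
have hmerit k : dotv (xi - x k.+1) (xi - x k.+1) +
    (dotv (yi - y k.+1) (yi - y k.+1) + dotv (li - lam k.+1) (li - lam k.+1))
    <= C * merit k.+1 xi yi li.
  rewrite (le_trans (hC _ _ _)) // ler_wpM2l // /merit -addrA lerDl.
  by rewrite addr_ge0 // mulr_ge0 ?dotv_ge0 ?xi3_ge0 ?xi4_ge0.
(* The merit function is controlled from index 1 on, so the shifted sequence is treated first. *)
have from_tail p (u : nat -> 'cV[R]_p) (v : 'cV[R]_p) :
    (forall k, dotv (v - u k.+1) (v - u k.+1) <= C * merit k.+1 xi yi li) ->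
    u k @[k --> \oo] --> v.
  move=> huv; rewrite -cvg_shiftS; apply: cvg_dotv0 => /=.
  apply: (dominated_cvg0 _ _ merit0) => k; first exact: dotv_ge0.
  by apply: le_trans (huv k); rewrite -opprB dotvNl dotvNr opprK.
exists xi, yi, li; split=> //; apply: from_tail => k; have := hmerit k;
  have := dotv_ge0 (xi - x k.+1); have := dotv_ge0 (yi - y k.+1);
  have := dotv_ge0 (li - lam k.+1); lra.
Qed.

End WithSaddle.
End Convergence.

End Iterates.
End TwoBlockADMM.

(** * Proximal steps over a family of blocks *)

Section Convexity.
Variable R : realType.

Lemma convex_setE n (D : set 'cV[R]_n) : convex_set D ->
  forall a b (t : R), 0 <= t -> t <= 1 -> D a -> D b ->
  D (t *: a + (1 - t) *: b).
Proof.
move=> cD a b t t0 t1 Da Db.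
by have := cD a b (Itv01 t0 t1) (mem_set Da) (mem_set Db); rewrite inE.
Qed.

Lemma convex_functionE n (F : 'cV[R]_n -> R) :
  convex_function [set: 'cV[R]_n] F ->
  forall a b (t : R), 0 <= t -> t <= 1 ->
  F (t *: a + (1 - t) *: b) <= t * F a + (1 - t) * F b.
Proof.
move=> cF a b t t0 t1.
by have := cF (Itv01 t0 t1) a b (mem_set I) (mem_set I).
Qed.

Lemma invS_weight (a : R) : 0 < a -> (a + 1)^-1 = (1 - (a + 1)^-1) * a^-1.
Proof.
move=> a0; have a1 : 0 < a + 1 by rewrite addr_gt0.
by field; rewrite !gt_eqF.
Qed.

Lemma ergodic_meanS n (v : nat -> 'cV[R]_n) t :
  ergodic_mean v t.+1 =
  t.+1%:R^-1 *: v t.+1 + (1 - t.+1%:R^-1) *: ergodic_mean v t.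
Proof.
rewrite /ergodic_mean big_nat_recr //= scalerDr addrC; congr (_ + _).
case: t => [|t]; first by rewrite big_geq // !scaler0.
rewrite scalerA; congr (_ *: _).
by rewrite -[t.+2%:R]natr1; apply: invS_weight; rewrite ltr0n.
Qed.

(** Jensen's inequality by induction: each new mean is a two-point convex combination of the new
    term and the old mean. *)
Lemma ergodic_mean_convex n (F : 'cV[R]_n -> R) (v : nat -> 'cV[R]_n) t :
  convex_function [set: 'cV[R]_n] F -> (1 <= t)%N ->
  F (ergodic_mean v t) <= t%:R^-1 * \sum_(1 <= k < t.+1) F (v k).
Proof.
move=> cF; elim: t => // t IH _.
have [->|t0] := posnP t.
  by rewrite /ergodic_mean !big_nat1 invr1 scale1r mul1r.
rewrite ergodic_meanS (le_trans (convex_functionE cF _ _ _ _)) ?invr_ge0 //.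
  by rewrite invf_le1 // ler1n.
rewrite big_nat_recr //= mulrDr addrC lerD2r.
apply: le_trans (ler_wpM2l _ (IH t0)) _.
  by rewrite subr_ge0 invf_le1 // ler1n.
rewrite mulrA le_eqVlt; apply/orP; left; apply/eqP; congr (_ * _).
by rewrite -[t.+1%:R]natr1 -invS_weight // ltr0n.
Qed.

(** The point (l, F l - e) lies outside the closed epigraph, and so does a product neighbourhood of
    it; slice that at height F l - e. *)
Lemma lsc_near n (F : 'cV[R]_n -> R) : closed_proper_convex F ->
  forall (u : nat -> 'cV[R]_n) (l : 'cV[R]_n) (e : R), 0 < e ->
  u k @[k --> \oo] --> l -> \forall k \near \oo, F l - e < F (u k).
Proof.
move=> [cl _] u l e e0 ul.
have op : open (~` [set z : 'cV[R]_n * R | F z.1 <= z.2]) by exact: closed_openC.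
have nl : nbhs (l, F l - e) (~` [set z : 'cV[R]_n * R | F z.1 <= z.2]).
  have h : (~` [set z : 'cV[R]_n * R | F z.1 <= z.2]) (l, F l - e).
    by apply/negP; rewrite -ltNge /= ltrBlDr ltrDl.
  exact: (open_nbhs_nbhs (conj op h)).
case: nl => -[P Q] [/= Pl Qe] PQ; 
have uP : \forall k \near \oo, P (u k) := ul _ Pl.
apply: filterS uP => k Pk.
have := PQ (u k, F l - e) (conj Pk (nbhs_singleton Qe)).
by move=> /= /negP; rewrite -ltNge.
Qed.

(* Divide the minimality inequality at xp + t (z - xp) by t and let t -> 0. *)
Lemma small_t_nonneg (a b : R) :
  (forall t, 0 < t -> t <= 1 -> 0 <= t * a + t ^+ 2 * b) -> 0 <= a.
Proof.
move=> h; rewrite leNgt; apply/negP => a0.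
(* With this [t], t |b| is below - a / 2, so a + t b stays negative. *)
pose t := Num.min 1 (- a / (2 * (`|b| + 1))).
have b1 : 0 < 2 * (`|b| + 1) by rewrite mulr_gt0 // ltr_wpDl.
have t0 : 0 < t by rewrite lt_min ltr01 divr_gt0 // oppr_gt0.
have t1 : t <= 1 by rewrite ge_min lexx.
have := h t t0 t1.
have -> : t * a + t ^+ 2 * b = t * (a + t * b) by ring.
rewrite pmulr_rge0 // leNgt => /negP; apply.
have : t <= - a / (2 * (`|b| + 1)) by rewrite ge_min lexx orbT.
rewrite ler_pdivlMr // => tb.
have h1 : t * b <= t * `|b| by rewrite ler_wpM2l ?ler_norm // ltW.
lra.
Qed.

(** Move from [xp] towards [z] by [t]: convexity bounds [F] linearly in [t], the quadratic part is
    exact, and [small_t_nonneg] extracts the linear coefficient. The factor sigma + 1 adds the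
    penalty to the proximal term. *)
Lemma argmin_quadratic_vi n k (F : 'cV[R]_k -> R) (D : set 'cV[R]_k)
    (N : 'M[R]_(n, k)) (L : 'cV[R]_k -> R) K lam r0 beta sigma (x xp : 'cV[R]_k) :
  convex_function [set: 'cV[R]_k] F -> convex_set D ->
  (forall z, L z = K + F z - dotv lam (r0 + N *m (z - x))
    + beta / 2 * dotv (r0 + N *m (z - x)) (r0 + N *m (z - x))
    + sigma * beta / 2 * dotv (N *m (z - x)) (N *m (z - x))) ->
  is_argmin D L xp ->
  forall z, D z -> F xp - F z <= - dotv (N *m (z - xp)) (lam - beta *: r0)
    + (sigma + 1) * beta * dotv (N *m (z - xp)) (N *m (xp - x)).
Proof.
move=> cF cD LE [Dxp min] z Dz; rewrite -subr_ge0.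
apply: (@small_t_nonneg _ ((sigma + 1) * beta / 2 *
  dotv (N *m (z - xp)) (N *m (z - xp)))) => t t0 t1.
have Dt := convex_setE cD (ltW t0) t1 Dz Dxp.
have Ft := convex_functionE cF z xp (ltW t0) t1.
have := min _ Dt; rewrite !LE.
have -> : N *m (t *: z + (1 - t) *: xp - x) = N *m (xp - x) + t *: (N *m (z - xp)).
  rewrite scalemxAr -mulmxDr; congr (_ *m _).
  by apply/matrixP => i j; rewrite !mxE; ring.
move: (N *m (xp - x)) (N *m (z - xp)) => q w.
rewrite !dotv_bilin (dotvC q r0) (dotvC w r0) (dotvC w q) (dotvC w lam).
lra.
Qed.

End Convexity.

(** * Block forms and parallel proximal sweeps *)

Section BlockFamilies.
Variables (R : realType) (n p : nat) (D : 'I_p -> nat).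
Variable M : forall i, 'M[R]_(n, D i).
Variable F : forall i, 'cV[R]_(D i) -> R.
Variable S : forall i, set 'cV[R]_(D i).

Local Notation V := 'cV[R]_(\sum_i D i).

Definition block_sum (v : V) : R := \sum_i F (submxcol v i).
Definition block_set : set V := [set v | forall i, S (submxcol v i)].
(** One shape for [Hx] and [Hy] and, with other coefficients, for the blocks [Hyy] and [Hxx']. *)
Definition block_form (a b : R) : 'M[R]_(\sum_i D i) :=
  \mxblock_(i, l) ((if i == l then a else b) *: ((M i)^T *m M l)).

Lemma mxrow_mul_col (v : V) :
  (\mxrow_i M i) *m v = \sum_i M i *m submxcol v i.
Proof. by rewrite -[in LHS](submxcolK v) mul_mxrow_mxcol. Qed.

Lemma mxrow_mul_subst (v : V) i (xi : 'cV[R]_(D i)) :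
  (\mxrow_i M i) *m (\mxcol_l dfwith (submxcol v) i xi l) =
  (\mxrow_i M i) *m v + M i *m (xi - submxcol v i).
Proof.
rewrite !mxrow_mul_col (bigD1 i) //= [in RHS](bigD1 i) //= mxcolK dfwithin.
rewrite (eq_bigr (fun l => M l *m submxcol v l)) => [|l li]; last first.
  by rewrite mxcolK dfwithout // eq_sym.
rewrite mulmxBr; move: (M i *m xi) (M i *m submxcol v i) => a b.
by rewrite (addrC b) -addrA [b + _]addrC subrK addrC.
Qed.

Lemma block_sum_subst (v : V) i (xi : 'cV[R]_(D i)) :
  block_sum (\mxcol_l dfwith (submxcol v) i xi l) =
  F xi + \sum_(l | l != i) F (submxcol v l).
Proof.
rewrite /block_sum (bigD1 i) //= mxcolK dfwithin; congr (_ + _).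
by apply: eq_bigr => l li; rewrite mxcolK dfwithout // eq_sym.
Qed.

(** Taking [b] on every block gives [b] times the Gram form of the concatenated matrix; the excess a
    - b is block diagonal. *)
Lemma block_formE a b (u v : V) :
  dotv u (block_form a b *m v) =
  (a - b) * \sum_i dotv (M i *m submxcol u i) (M i *m submxcol v i)
  + b * dotv ((\mxrow_i M i) *m u) ((\mxrow_i M i) *m v).
Proof.
rewrite -[in LHS](submxcolK v) mul_mxblock_mxrow dotv_mxcol.
rewrite !mxrow_mul_col dotv_suml !mulr_sumr -big_split /=.
apply: eq_bigr => i _; rewrite mxcolK !dotv_sumr mulr_sumr.
rewrite (bigD1 i) //= eqxx [in RHS](bigD1 i) //= addrA; congr (_ + _).
  by rewrite -scalemxAl dotvZr -mulmxA dotv_trmx; ring.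
apply: eq_bigr => l li; rewrite eq_sym (negbTE li).
by rewrite -scalemxAl dotvZr -mulmxA dotv_trmx.
Qed.

Lemma block_form_sym a b : (block_form a b)^T = block_form a b.
Proof.
rewrite /block_form tr_mxblock; apply: eq_mxblock => i l.
by rewrite linearZ /= trmx_mul trmxK eq_sym.
Qed.

(** By [block_formE] the form is beta ((sigma + 1) T - |M v|^2) with T the sum of |M_i v_i|^2, and
    |M v|^2 <= p T. Thus sigma > p - 1 leaves a positive multiple of [T]. *)
Lemma block_form_coercive sigma beta :
  0 < beta -> p%:R - 1 < sigma -> (forall i, \rank (M i) = D i) ->
  exists2 c : R, 0 < c &
    forall v, c * dotv v v <= dotv v (block_form (sigma * beta) (- beta) *m v).
Proof.
move=> b0 hs hM.
have /choice[C hC] : forall i, exists C, 0 <= C /\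
    forall v, dotv v v <= C * dotv (M i *m v) (M i *m v).
  (* Full column rank provides a left inverse [N], whose operator bound controls [v] by its
     image. *)
  move=> i; have /row_fullP[N NM] : row_full (M i) by rewrite /row_full hM.
  have [C C0 hC] := dotv_mulmx_bound N; exists C; split=> // v.
  by have := hC (M i *m v); rewrite mulmxA NM mul1mx.
have CS0 : 0 <= \sum_i C i by apply: sumr_ge0 => i _; have [] := hC i.
have CS1 : 0 < 1 + \sum_i C i by rewrite ltr_wpDr.
have sp : 0 < sigma + 1 - p%:R by lra.
exists (beta * (sigma + 1 - p%:R) / (1 + \sum_i C i)).
  by rewrite divr_gt0 // mulr_gt0.
move=> v; rewrite block_formE mulrAC ler_pdivrMr //.
set T := \sum_i dotv (M i *m submxcol v i) (M i *m submxcol v i).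
have T0 : 0 <= T by apply: sumr_ge0 => i _; exact: dotv_ge0.
have h1 : dotv v v <= (1 + \sum_i C i) * T.
  rewrite dotv_mxcol mulrDl mul1r mulr_suml ler_wpDl //.
  apply: ler_sum => i _; have [Ci0 /(_ (submxcol v i)) h] := hC i.
  apply: (le_trans h); rewrite ler_wpM2l // /T (bigD1 i) //= lerDl.
  by apply: sumr_ge0 => l _; exact: dotv_ge0.
have h2 : dotv ((\mxrow_i M i) *m v) ((\mxrow_i M i) *m v) <= p%:R * T.
  by rewrite mxrow_mul_col; exact: dotv_sum_le_card.
apply: (@le_trans _ _ (beta * (sigma + 1 - p%:R) * ((1 + \sum_i C i) * T))).
  by rewrite ler_wpM2l // ltW // mulr_gt0.
rewrite mulrCA mulrC ler_wpM2r ?(ltW CS1) //.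
by have := ler_wpM2l (ltW b0) h2; move: (p%:R : R) (dotv _ _) => q r; lra.
Qed.

(** Each block sees the others frozen, so its inequality carries the old residual [r0]. Moving to
    the new residual after summation costs exactly the Gram term with coefficient - beta in the
    block form. *)
Lemma block_prox_vi (L : forall i, 'cV[R]_(D i) -> R) K lam r0 beta sigma
    (x xp : V) :
  (forall i, convex_function [set: 'cV[R]_(D i)] (@F i)) ->
  (forall i, convex_set (@S i)) ->
  (forall i z, L i z = K i + F z - dotv lam (r0 + M i *m (z - submxcol x i))
    + beta / 2 * dotv (r0 + M i *m (z - submxcol x i))
        (r0 + M i *m (z - submxcol x i))
    + sigma * beta / 2 * dotv (M i *m (z - submxcol x i))
        (M i *m (z - submxcol x i))) ->
  (forall i, is_argmin (@S i) (L i) (submxcol xp i)) ->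
  prox_vi block_sum block_set (\mxrow_i M i)
    (block_form (sigma * beta) (- beta)) x xp
    (lam - beta *: (r0 + (\mxrow_i M i) *m (xp - x))).
Proof.
move=> cF cS LE min; split=> [i|z Sz]; first by have [] := min i.
have hi i := argmin_quadratic_vi (cF i) (cS i) (LE i) (min i) (Sz i).
rewrite block_formE /block_sum -sumrB (le_trans (ler_sum _ (fun i _ => hi i))) //.
rewrite big_split /= sumrN -dotv_suml -mulr_sumr.
have -> : \sum_i M i *m (submxcol z i - submxcol xp i) = (\mxrow_i M i) *m (z - xp).
  by rewrite mxrow_mul_col; apply: eq_bigr => i _; rewrite submxcolB.
have -> : \sum_i dotv (M i *m submxcol (z - xp) i) (M i *m submxcol (xp - x) i) =
    \sum_i dotv (M i *m (submxcol z i - submxcol xp i))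
                (M i *m (submxcol xp i - submxcol x i)).
  by apply: eq_bigr => i _; rewrite !submxcolB.
move: ((\mxrow_i M i) *m (z - xp)) ((\mxrow_i M i) *m (xp - x)) => u w.
by rewrite !dotv_bilin; lra.
Qed.

Lemma cvg_submxcol (u : nat -> V) (l : V) i :
  u k @[k --> \oo] --> l -> submxcol (u k) i @[k --> \oo] --> submxcol l i.
Proof.
move=> /cvg_mxP ul; apply/cvg_mxP => a b; rewrite mxE.
by under eq_fun do rewrite mxE; exact: ul.
Qed.

Lemma block_set_closed : (forall i, closed (@S i)) -> seq_closed block_set.
Proof.
move=> cS u l uS ul i.
have uSi : \forall k \near \oo, S (submxcol (u k) i) by apply: nearW => k; exact: uS.
exact: (@closed_cvg _ _ _ _ (fun k => submxcol (u k) i) _ (cS i) uSi _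
  (cvg_submxcol ul)).
Qed.

Lemma block_sum_lsc :
  (forall i, closed_proper_convex (@F i)) -> seq_lsc block_sum.
Proof.
move=> cF u l r t ul rt ur; apply/ler_addgt0Pr => e e0.
(* The slack is shared among the blocks; [p.+1] keeps the quotient meaningful when there are
   none. *)
pose d := e / p.+1%:R.
have d0 : 0 < d by rewrite divr_gt0.
rewrite -lerBlDr; apply: (ler_cvg_to (cvg_cst _) rt).
have /filter_forall H : forall i, \forall k \near \oo,
    F (submxcol l i) - d < F (submxcol (u k) i).
  by move=> i; apply: (lsc_near (cF i)) => //; exact: cvg_submxcol.
apply: filterS H => k H; apply: le_trans (ur k).
apply: (@le_trans _ _ (\sum_i (F (submxcol l i) - d))).
  rewrite sumrB lerB // sumr_const card_ord -mulr_natr /d.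
  by rewrite -mulrA ler_piMr ?ltW // mulrC ltr_pdivrMr // mul1r ltr_nat.
by apply: ler_sum => i _; exact: ltW.
Qed.

End BlockFamilies.

(** * GS-ADMM as a two-block scheme *)

(** Undoes the completion of squares, since - tau + tau^2 / (tau + s) = - tau s / (tau + s). *)
Lemma lyap_block (R : realType) (n m p : nat) (D : 'I_p -> nat)
    (M : forall i, 'M[R]_(n, D i)) (Hx : 'M[R]_m) (beta sigma tau s : R)
    (x : 'cV[R]_m) (y : 'cV[R]_(\sum_i D i)) (l : 'cV[R]_n) :
  0 < beta -> 0 < tau + s ->
  lyap (\mxrow_i M i) Hx (block_form M (sigma * beta) (- beta)) beta tau s x y l =
  dotv x (Hx *m x)
  + dotv y (block_form M ((sigma + 1 - tau * s / (tau + s)) * beta)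
              (- (tau * s / (tau + s)) * beta) *m y)
  - 2 * (tau / (tau + s)) * dotv ((\mxrow_i M i) *m y) l
  + (beta * (tau + s))^-1 * dotv l l.
Proof.
move=> b0 ts0; rewrite /lyap !block_formE.
move: ((\mxrow_i M i) *m y) (\sum_i _) => b T.
rewrite !dotv_bilin (dotvC l b); field.
by rewrite !gt_eqF.
Qed.

Section Problem.
Variables (R : realType) (P : problem R).
Variables beta sigma1 sigma2 : R.

Local Notation fsum := (block_sum (fobj P)).
Local Notation gsum := (block_sum (gobj P)).

Lemma hobj_mku (x : xvec P) (y : yvec P) : hobj (mku x y) = fsum x + gsum y.
Proof. by rewrite /hobj /ux /uy /mku col_mxKu col_mxKd. Qed.

Lemma hobjE (u : uvec P) : hobj u = fsum (ux u) + gsum (uy u).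
Proof. by []. Qed.

Lemma wu_mkw (x : xvec P) (y : yvec P) l : wu (mkw x y l) = mku x y.
Proof. by rewrite /wu /mkw col_mxKu. Qed.

Lemma wl_mkw (x : xvec P) (y : yvec P) l : wl (mkw x y l) = l.
Proof. by rewrite /wl /mkw col_mxKd. Qed.

Lemma wx_mkw (x : xvec P) (y : yvec P) l : wx (mkw x y l) = x.
Proof. by rewrite /wx /wu /ux /mkw /mku !col_mxKu. Qed.

Lemma wy_mkw (x : xvec P) (y : yvec P) l : wy (mkw x y l) = y.
Proof. by rewrite /wy /wu /uy /mkw /mku col_mxKu col_mxKd. Qed.

Lemma mkwK (w : wvec P) : mkw (wx w) (wy w) (wl w) = w.
Proof. by rewrite /mkw /mku !vsubmxK. Qed.

Lemma mkwB (x x' : xvec P) (y y' : yvec P) l l' :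
  mkw x y l - mkw x' y' l' = mkw (x - x') (y - y') (l - l').
Proof. by rewrite /mkw /mku !opp_col_mx !add_col_mx. Qed.

Lemma dotv_mkw (x x' : xvec P) (y y' : yvec P) l l' :
  dotv (mkw x y l) (mkw x' y' l') = dotv x x' + dotv y y' + dotv l l'.
Proof. by rewrite !dotv_col_mx. Qed.

Lemma gap_mkw (x : xvec P) (y : yvec P) (l : lvec P) (w : wvec P) :
  gap (calA P) (calB P) (cvec P) fsum gsum x y l (wx w) (wy w) (wl w) =
  hobj (mku x y) - hobj (wu w) + dotv (mkw x y l - w) (calJ w).
Proof.
have -> : mkw x y l - w = mkw (x - wx w) (y - wy w) (l - wl w).
  by rewrite -mkwB mkwK.
rewrite /calJ dotv_mkw !dotvNr !dotv_trmx /gap (dotvDl (calA P *m _)).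
rewrite hobj_mku hobjE -/(wx w) -/(wy w) -/(resid (wx w) (wy w)).
by ring.
Qed.

(** The symmetry that transfers the two-block analysis to the order (y, x). *)
Lemma gap_swap (x x' : xvec P) (y y' : yvec P) (l l' : lvec P) :
  gap (calB P) (calA P) (cvec P) gsum fsum y x l y' x' l' =
  gap (calA P) (calB P) (cvec P) fsum gsum x y l x' y' l'.
Proof.
rewrite /gap [calB P *m (y - y') + _]addrC [calB P *m y' + _]addrC.
by ring.
Qed.

Lemma Mstar_saddle (w : wvec P) : Mstar P w <->
  saddle (calA P) (calB P) (cvec P) fsum gsum (calX P) (calY P) (wx w) (wy w) (wl w).
Proof.
split=> [[[Xw Yw] wmin]|[Xw Yw wmin]].
  split=> // x y l Xx Yy; rewrite gap_mkw.
  have := wmin (mkw x y l).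
  by rewrite wu_mkw; apply; split; rewrite ?wx_mkw ?wy_mkw.
split=> // w' [Xw' Yw'].
have := wmin _ _ (wl w') Xw' Yw'; rewrite gap_mkw mkwK.
by rewrite /mku vsubmxK.
Qed.

Lemma saddle_swap (x : xvec P) (y : yvec P) (l : lvec P) :
  saddle (calB P) (calA P) (cvec P) gsum fsum (calY P) (calX P) y x l <->
  saddle (calA P) (calB P) (cvec P) fsum gsum (calX P) (calY P) x y l.
Proof.
split=> -[Xx Yy h]; split=> // x' y' l' Xx' Yy'.
  by rewrite -gap_swap; exact: h.
by rewrite gap_swap; exact: h.
Qed.

Lemma resid_xsubst (x : xvec P) (y : yvec P) i (xi : 'cV[R]_(dimx P i)) :
  resid (xsubst x xi) y = resid x y + Amx P i *m (xi - xblk x i).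
Proof.
by rewrite /resid /calA /xsubst mxrow_mul_subst -!addrA [Amx P i *m _ + _]addrC !addrA.
Qed.

Lemma resid_ysubst (x : xvec P) (y : yvec P) j (yj : 'cV[R]_(dimy P j)) :
  resid x (ysubst y yj) = resid x y + Bmx P j *m (yj - yblk y j).
Proof.
by rewrite /resid /calB /ysubst mxrow_mul_subst -!addrA [Bmx P j *m _ + _]addrC.
Qed.

Section Steps.
Hypothesis hf : forall i, closed_proper_convex (fobj P i).
Hypothesis hg : forall j, closed_proper_convex (gobj P j).
Hypothesis hX : forall i, closed (Xset P i) /\ convex_set (Xset P i).
Hypothesis hY : forall j, closed (Yset P j) /\ convex_set (Yset P j).

Lemma x_step_vi (x xn : xvec P) (y : yvec P) (lam : lvec P) :
  x_step beta sigma1 x y lam xn ->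
  prox_vi fsum (calX P) (calA P) (Hx P beta sigma1) x xn
    (lam - beta *: resid xn y).
Proof.
move=> step.
have -> : resid xn y = resid x y + calA P *m (xn - x).
  by rewrite mulmxBr /resid; apply/matrixP => i j; rewrite !mxE; ring.
(* [K] collects the objective values of all blocks held fixed. *)
apply: (block_prox_vi (K := fun i => \sum_(l | l != i) fobj P l (submxcol x l)
  + gsum y) _ _ _ step).
- by move=> i; have [] := hf i.
- by move=> i; have [] := hX i.
move=> i z; rewrite /auglag !enorm_sqr resid_xsubst hobj_mku block_sum_subst.
by ring.
Qed.

Lemma y_step_vi (x : xvec P) (y yn : yvec P) (lam : lvec P) :
  y_step beta sigma2 x y lam yn ->
  prox_vi gsum (calY P) (calB P) (Hy P beta sigma2) y yn
    (lam - beta *: resid x yn).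
Proof.
move=> step.
have -> : resid x yn = resid x y + calB P *m (yn - y).
  by rewrite mulmxBr /resid; apply/matrixP => i j; rewrite !mxE; ring.
apply: (block_prox_vi (K := fun j => \sum_(l | l != j) gobj P l (submxcol y l)
  + fsum x) _ _ _ step).
- by move=> i; have [] := hg i.
- by move=> i; have [] := hY i.
move=> i z; rewrite /auglag !enorm_sqr resid_ysubst hobj_mku block_sum_subst.
by ring.
Qed.

Lemma gs_admm_vi tau s x y lam lamh :
  gs_admm beta sigma1 sigma2 tau s x y lam lamh ->
  admm_vi (calA P) (calB P) (cvec P) fsum gsum (calX P) (calY P)
    (Hx P beta sigma1) (Hy P beta sigma2) beta tau s x y lam lamh.
Proof.
move=> [_ gs] k; have [xs lh ys lS] := gs k.
split; [exact: x_step_vi|exact: lh|exact: y_step_vi|exact: lS].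
Qed.

Lemma residC (x : xvec P) (y : yvec P) :
  calB P *m y + calA P *m x - cvec P = resid x y.
Proof. by rewrite [calB P *m y + _]addrC. Qed.

(* The re-indexed sweep is the two-block scheme in the order (y, x), with tau and
   s exchanged; its integer-index multiplier is lamh and its half-step one lam. *)
Lemma gs_admm_reindexed_vi tau s x y lam lamh :
  gs_admm_reindexed beta sigma1 sigma2 tau s x y lam lamh ->
  admm_vi (calB P) (calA P) (cvec P) gsum fsum (calY P) (calX P)
    (Hy P beta sigma2) (Hx P beta sigma1) beta s tau y x lamh lam.
Proof.
move=> gs k; have [ys l1 xs l2] := gs k; rewrite !residC.
split; [exact: y_step_vi|exact: l1|exact: x_step_vi|exact: l2].
Qed.

Lemma hobj_convex : convex_function [set: uvec P] (@hobj R P).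
Proof.
move=> t u v _ _; set a := t%:num; set b := 1 - a.
have cx i : xblk (ux (a *: u + b *: v)) i = a *: xblk (ux u) i + b *: xblk (ux v) i.
  by apply/matrixP => k l; rewrite !mxE.
have cy j : yblk (uy (a *: u + b *: v)) j = a *: yblk (uy u) j + b *: yblk (uy v) j.
  by apply/matrixP => k l; rewrite !mxE.
have a0 : 0 <= a by rewrite /a.
have a1 : a <= 1 by rewrite /a.
change (hobj (a *: u + b *: v) <= a * hobj u + b * hobj v).
rewrite /hobj !mulrDr addrACA !mulr_sumr -!big_split /= lerD //.
  by apply: ler_sum => i _; rewrite cx; apply: convex_functionE => //; have [] := hf i.
by apply: ler_sum => j _; rewrite cy; apply: convex_functionE => //; have [] := hg j.
Qed.

(** Jensen for [hobj]; the pairing is affine in its first point because [calJ] is evaluated at the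
    fixed [w]. *)
Lemma ergodic_gap_le (u : nat -> uvec P) (v : nat -> wvec P) (w : wvec P) C t :
  (1 <= t)%N ->
  \sum_(1 <= k < t.+1) (hobj (u k) - hobj (wu w) + dotv (v k - w) (calJ w))
    <= C / 2 ->
  hobj (ergodic_mean u t) - hobj (wu w) + dotv (ergodic_mean v t - w) (calJ w)
    <= 1 / (2 * t%:R) * C.
Proof.
move=> t1 hC.
have t0 : (0 : R) < t%:R by rewrite ltr0n.
have tV : 0 <= (t%:R : R)^-1 by rewrite invr_ge0 ltW.
have -> : 1 / (2 * t%:R) * C = t%:R^-1 * C / 2 by field; rewrite gt_eqF.
have := ler_wpM2l tV hC; rewrite big_split sumrB /=.
rewrite sumr_const_nat subSS subn0 -[hobj _ *+ t]mulr_natl.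
have -> : \sum_(1 <= k < t.+1) dotv (v k - w) (calJ w) =
    \sum_(1 <= k < t.+1) dotv (v k) (calJ w) - t%:R * dotv w (calJ w).
  rewrite -dotv_suml sumrB sumr_const_nat subSS subn0 dotvDl dotvNl dotv_suml.
  by rewrite -scaler_nat dotvZl.
have := ergodic_mean_convex u hobj_convex t1.
rewrite dotvDl dotvNl /ergodic_mean dotvZl dotv_suml.
set S1 := \sum_(1 <= k < t.+1) hobj _; set S2 := \sum_(1 <= k < t.+1) dotv _ _.
move: (hobj (_ *: _)) (hobj (wu w)) => h h'.
rewrite !mulrDr !mulrN !mulrA mulVf ?gt_eqF // !mul1r => h1 h2.
lra.
Qed.

Lemma qnorm2_Hmx tau s (x : xvec P) (y : yvec P) (l : lvec P) :
  0 < beta -> 0 < tau + s ->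
  qnorm2 (Hmx P beta sigma1 sigma2 tau s) (mkw x y l) =
  lyap (calB P) (Hx P beta sigma1) (Hy P beta sigma2) beta tau s x y l.
Proof.
move=> b0 ts0; rewrite (lyap_block (Bmx P)) // qnorm2E /Hmx /mkw /mku.
rewrite !mul_block_col !mul_col_mx !mul_row_col !mul0mx !addr0 !add0r.
rewrite add_col_mx addr0 !dotv_col_mx !dotvDr dotv_trmx mul_scalar_mx dotvZr.
have -> : Hyl P tau s = - (tau / (tau + s)) *: (calB P)^T.
  by rewrite /calB tr_mxrow; apply/matrixP => i j; rewrite !mxE.
rewrite -scalemxAl dotvZr dotv_trmx dotvZl (dotvC _ y) dotv_trmx.
by rewrite /calB; ring.
Qed.

Lemma qnorm2_Hmx' tau s (x : xvec P) (y : yvec P) (l : lvec P) :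
  0 < beta -> 0 < tau + s ->
  qnorm2 (Hmx' P beta sigma1 sigma2 tau s) (mkw x y l) =
  lyap (calA P) (Hy P beta sigma2) (Hx P beta sigma1) beta s tau y x l.
Proof.
move=> b0 ts0; rewrite (lyap_block (Amx P)) // 1?[s + tau]addrC //.
rewrite qnorm2E /Hmx' /mkw /mku.
rewrite !mul_block_col !mul_col_mx !mul_row_col !mul0mx !addr0 !add0r.
rewrite add_col_mx addr0 !dotv_col_mx !dotvDr dotv_trmx mul_scalar_mx dotvZr.
have -> : Hxl' P tau s = - (s / (tau + s)) *: (calA P)^T.
  by rewrite /calA tr_mxrow; apply/matrixP => i j; rewrite !mxE.
rewrite -scalemxAl dotvZr dotv_trmx dotvZl (dotvC _ x) dotv_trmx.
rewrite [s * tau]mulrC /calA; ring.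
Qed.

End Steps.
End Problem.

(** * Global convergence and ergodic rate *)

Lemma Gdom_union (R : realType) : Kdom R `|` Kbar R = Gdom R.
Proof.
apply/seteqP; split=> -[tau s] /=; first by case=> -[].
move=> [/= ts0 dom]; have [t1|t1] := leP tau 1; first by left.
have [s1|s1] := leP s 1; first by right.
(* If tau and s both exceed 1, adding these three products to the domain polynomial gives 2 - tau -
   s, which is negative. *)
exfalso; have h1 : 0 < (tau - 1) * (s - 1) by rewrite mulr_gt0 ?subr_gt0.
have h2 : 0 < tau * (tau - 1) by rewrite mulr_gt0 ?subr_gt0 // (lt_trans ltr01).
have h3 : 0 < s * (s - 1) by rewrite mulr_gt0 ?subr_gt0 // (lt_trans ltr01).
lra.
Qed.

Section GlobalConvergence.
Variables (R : realType) (P : problem R).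
Variables beta sigma1 sigma2 : R.
Hypothesis hf : forall i, closed_proper_convex (fobj P i).
Hypothesis hg : forall j, closed_proper_convex (gobj P j).
Hypothesis hA : forall i, \rank (Amx P i) = dimx P i.
Hypothesis hB : forall j, \rank (Bmx P j) = dimy P j.
Hypothesis hX : forall i, closed (Xset P i) /\ convex_set (Xset P i).
Hypothesis hY : forall j, closed (Yset P j) /\ convex_set (Yset P j).
Hypothesis hbeta : 0 < beta.
Hypothesis hsigma1 : (np P)%:R - 1 < sigma1.
Hypothesis hsigma2 : (nq P)%:R - 1 < sigma2.

Lemma Hx_coercive : exists2 c : R, 0 < c &
  forall v, c * dotv v v <= dotv v (Hx P beta sigma1 *m v).
Proof. exact: block_form_coercive. Qed.

Lemma Hy_coercive : exists2 c : R, 0 < c &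
  forall v, c * dotv v v <= dotv v (Hy P beta sigma2 *m v).
Proof. exact: block_form_coercive. Qed.

Lemma Hx_psd v : 0 <= dotv v (Hx P beta sigma1 *m v).
Proof.
have [c c0 hc] := Hx_coercive.
by apply: le_trans (hc v); rewrite mulr_ge0 ?dotv_ge0 // ltW.
Qed.

Lemma Hy_psd v : 0 <= dotv v (Hy P beta sigma2 *m v).
Proof.
have [c c0 hc] := Hy_coercive.
by apply: le_trans (hc v); rewrite mulr_ge0 ?dotv_ge0 // ltW.
Qed.

Lemma Hx_sym : (Hx P beta sigma1)^T = Hx P beta sigma1.
Proof. exact: block_form_sym. Qed.

Lemma Hy_sym : (Hy P beta sigma2)^T = Hy P beta sigma2.
Proof. exact: block_form_sym. Qed.

Lemma cvg_enorm0 n (u : nat -> 'cV[R]_n) :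
  u k @[k --> \oo] --> (0 : 'cV[R]_n) -> enorm (u k) @[k --> \oo] --> (0 : R).
Proof.
move=> u0; have := cvg_dotv u0 u0; rewrite dotv0l => h.
have := cvg_comp _ _ h (@sqrt_continuous R 0).
by rewrite /= sqrtr0.
Qed.

Lemma successive_diff2_cvg0 (x : nat -> xvec P) (y : nat -> yvec P)
    (xi : xvec P) (yi : yvec P) :
  x k @[k --> \oo] --> xi -> y k @[k --> \oo] --> yi ->
  successive_diff2 x y k @[k --> \oo] --> (0 : R).
Proof.
have diff0 p (D : 'I_p -> nat) n (M : forall i, 'M[R]_(n, D i))
    (u : nat -> 'cV[R]_(\sum_i D i)) (l : 'cV[R]_(\sum_i D i)) :
    u k @[k --> \oo] --> l ->
    \sum_i enorm (M i *m (submxcol (u k) i - submxcol (u k.+1) i)) ^+ 2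
      @[k --> \oo] --> (0 : R).
  move=> ul.
  have := @cvg_sum_ord R p (fun i k =>
    enorm (M i *m (submxcol (u k) i - submxcol (u k.+1) i)) ^+ 2) (fun=> 0).
  rewrite big1 //; apply=> i.
  under eq_fun do rewrite enorm_sqr.
  have h : M i *m (submxcol (u k) i - submxcol (u k.+1) i) @[k --> \oo]
      --> (0 : 'cV[R]_n).
    rewrite -(mulmx0 _ (M i)) -(subrr (submxcol l i)).
    apply: cvg_mulmx; apply: cvgB; apply: cvg_submxcol => //.
    exact: (cvg_subseq (phi := succn)).
  by have := cvg_dotv h h; rewrite dotv0l.
move=> xl yl; rewrite -[0]addr0; apply: cvgD.
  exact: (diff0 _ _ _ (Amx P) _ _ xl).
exact: (diff0 _ _ _ (Bmx P) _ _ yl).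
Qed.

Lemma cvg_resid (x : nat -> xvec P) (y : nat -> yvec P)
    (xi : xvec P) (yi : yvec P) :
  x k @[k --> \oo] --> xi -> y k @[k --> \oo] --> yi ->
  resid (x k) (y k) @[k --> \oo] --> resid xi yi.
Proof. exact: cvg_res. Qed.

Lemma cvg_mult_resid (a : R) (l : nat -> lvec P) (x : nat -> xvec P)
    (y : nat -> yvec P) (xi : xvec P) (yi : yvec P) (li : lvec P) :
  resid xi yi = 0 -> l k @[k --> \oo] --> li ->
  x k @[k --> \oo] --> xi -> y k @[k --> \oo] --> yi ->
  l k - a *: resid (x k) (y k) @[k --> \oo] --> li.
Proof.
move=> r0 ll xl yl.
rewrite -[X in _ --> X]subr0 -(scaler0 _ a) -r0.
by apply: cvgB => //; apply: cvgZr; exact: cvg_resid.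
Qed.

Lemma gs_admm_limit tau s x y lam lamh :
  Mstar P !=set0 -> Kdom R (tau, s) ->
  gs_admm beta sigma1 sigma2 tau s x y lam lamh ->
  exists xi yi li, [/\ Mstar P (mkw xi yi li), resid xi yi = 0,
    x k @[k --> \oo] --> xi, y k @[k --> \oo] --> yi & lam k @[k --> \oo] --> li].
Proof.
move=> [ws /Mstar_saddle sad] [/= ts0 t1 dom] gs.
have [cx cx0 hcx] := Hx_coercive; have [cy cy0 hcy] := Hy_coercive.
have [xi [yi [li [sadi r0 xl yl ll]]]] :=
  admm_converges Hx_sym Hy_sym Hx_psd Hy_psd hbeta ts0 t1 dom
    (gs_admm_vi hf hg hX hY gs) cx0 cy0 hcx hcy
    (block_set_closed (fun i => (hX i).1)) (block_set_closed (fun j => (hY j).1))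
    (block_sum_lsc hf) (block_sum_lsc hg) sad.
exists xi, yi, li; split=> //.
by apply/Mstar_saddle; rewrite wx_mkw wy_mkw wl_mkw.
Qed.

Lemma gs_admm_reindexed_limit tau s x y lam lamh :
  Mstar P !=set0 -> Kbar R (tau, s) ->
  gs_admm_reindexed beta sigma1 sigma2 tau s x y lam lamh ->
  exists xi yi li, [/\ Mstar P (mkw xi yi li), resid xi yi = 0,
    x k @[k --> \oo] --> xi, y k @[k --> \oo] --> yi & lamh k @[k --> \oo] --> li].
Proof.
move=> [ws /Mstar_saddle/saddle_swap sad] [/= ts0 s1 dom] gs.
have [cx cx0 hcx] := Hx_coercive; have [cy cy0 hcy] := Hy_coercive.
have st0 : 0 < s + tau by rewrite addrC.
have dom' : 0 < - s ^+ 2 - tau ^+ 2 - s * tau + s + tau + 1 by lra.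
have [yi [xi [li [sadi r0 yl xl ll]]]] :=
  admm_converges Hy_sym Hx_sym Hy_psd Hx_psd hbeta st0 s1 dom'
    (gs_admm_reindexed_vi hf hg hX hY gs) cy0 cx0 hcy hcx
    (block_set_closed (fun j => (hY j).1)) (block_set_closed (fun i => (hX i).1))
    (block_sum_lsc hg) (block_sum_lsc hf) sad.
exists xi, yi, li; split=> //; last by rewrite -residC.
by apply/Mstar_saddle; rewrite wx_mkw wy_mkw wl_mkw; apply/saddle_swap.
Qed.

(** The first x-sweep and half-step become initial data. The array [lamh] is not shifted, since its
    entry [k] means k + 1/2 before and k - 1/2 after re-indexing. *)
Lemma gs_admm_reindex tau s (x : nat -> xvec P) (y : nat -> yvec P)
    (lam lamh : nat -> lvec P) :
  gs_admm beta sigma1 sigma2 tau s x y lam lamh ->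
  gs_admm_reindexed beta sigma1 sigma2 tau s
    (fun k => x k.+1) y (fun k => lam k.+1) lamh.
Proof.
move=> [_ gs] k; have [_ _ ys lS] := gs k; have [xs lh _ _] := gs k.+1.
by split.
Qed.

Lemma gs_admm_limit_Gdom tau s x y lam lamh :
  Mstar P !=set0 -> Gdom R (tau, s) ->
  gs_admm beta sigma1 sigma2 tau s x y lam lamh ->
  exists xi yi li, [/\ Mstar P (mkw xi yi li), resid xi yi = 0,
    x k @[k --> \oo] --> xi, y k @[k --> \oo] --> yi & lam k @[k --> \oo] --> li].
Proof.
move=> Ms; rewrite -Gdom_union => -[Kts|Kts] gs; first exact: gs_admm_limit gs.
have [xi [yi [li [Mi r0 xl yl ll]]]] :=
  gs_admm_reindexed_limit Ms Kts (gs_admm_reindex gs).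
exists xi, yi, li; split=> //; first by rewrite -cvg_shiftS.
(* The re-indexed limit concerns [lamh]; the last update recovers [lam], as the residual
   vanishes. *)
rewrite -cvg_shiftS /=.
have -> : (fun k => lam k.+1) =
    (fun k => lamh k - (s * beta) *: resid (x k.+1) (y k.+1)).
  by apply/funext => k; have [_ /(_ k)[]] := gs.
by apply: (cvg_mult_resid _ r0) => //; rewrite cvg_shiftS.
Qed.

Lemma gs_admm_global tau s x y lam lamh :
  Mstar P !=set0 -> Gdom R (tau, s) ->
  gs_admm beta sigma1 sigma2 tau s x y lam lamh ->
  [/\ successive_diff2 x y k @[k --> \oo] --> (0 : R),
      enorm (resid (x k) (y k)) @[k --> \oo] --> (0 : R) &
      exists2 winf : wvec P, Mstar P winf &
        wtilde beta x y lam k @[k --> \oo] --> winf].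
Proof.
move=> Ms Gts gs; have [xi [yi [li [Mi r0 xl yl ll]]]] := gs_admm_limit_Gdom Ms Gts gs.
have xl1 : x k.+1 @[k --> \oo] --> xi by exact: (cvg_subseq (phi := succn)).
have yl1 : y k.+1 @[k --> \oo] --> yi by exact: (cvg_subseq (phi := succn)).
split.
- exact: successive_diff2_cvg0 xl yl.
- by apply: cvg_enorm0; rewrite -r0; exact: cvg_resid.
- exists (mkw xi yi li) => //; apply: cvg_col_mx; first exact: cvg_col_mx.
  exact: (cvg_mult_resid _ r0 ll xl1 yl).
Qed.

Lemma gs_admm_reindexed_global tau s x y lam lamh :
  Mstar P !=set0 -> Kbar R (tau, s) ->
  gs_admm_reindexed beta sigma1 sigma2 tau s x y lam lamh ->
  [/\ successive_diff2 x y k @[k --> \oo] --> (0 : R),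
      enorm (resid (x k) (y k)) @[k --> \oo] --> (0 : R) &
      exists2 winf : wvec P, Mstar P winf &
        what beta x y lamh k @[k --> \oo] --> winf].
Proof.
move=> Ms Kts gs.
have [xi [yi [li [Mi r0 xl yl ll]]]] := gs_admm_reindexed_limit Ms Kts gs.
have xl1 : x k.+1 @[k --> \oo] --> xi by exact: (cvg_subseq (phi := succn)).
have yl1 : y k.+1 @[k --> \oo] --> yi by exact: (cvg_subseq (phi := succn)).
split.
- exact: successive_diff2_cvg0 xl yl.
- by apply: cvg_enorm0; rewrite -r0; exact: cvg_resid.
- exists (mkw xi yi li) => //; apply: cvg_col_mx; first exact: cvg_col_mx.
  exact: (cvg_mult_resid _ r0 ll xl yl1).
Qed.

Lemma gs_admm_ergodic tau s x y lam lamh (t : nat) (w : wvec P) :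
  Kdom R (tau, s) -> gs_admm beta sigma1 sigma2 tau s x y lam lamh ->
  (1 <= t)%N -> calM P w ->
  hobj (ergodic_mean (utilde x y) t) - hobj (wu w) +
    dotv (ergodic_mean (wtilde beta x y lam) t - w) (calJ w) <=
  1 / (2 * t%:R) *
    (qnorm2 (Hmx P beta sigma1 sigma2 tau s)
       (w - mkw (x 1%N) (y 1%N) (lam 1%N)) +
     xi3 beta tau s * enorm (resid (x 1%N) (y 1%N)) ^+ 2 +
     xi4 tau * qnorm2 (Hy P beta sigma2) (y 1%N - y 0%N)).
Proof.
move=> [/= ts0 t1 dom] gs t_gt0 [Xw Yw]; apply: ergodic_gap_le => //.
have := sum_gap_le Hx_sym Hy_sym Hx_psd Hy_psd hbeta ts0 t1 dom
  (gs_admm_vi hf hg hX hY gs) t (wl w) Xw Yw.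
rewrite -[in qnorm2 _ (w - _)](mkwK w) mkwB qnorm2_Hmx // qnorm2E enorm_sqr.
apply: le_trans; rewrite le_eqVlt; apply/orP; left; apply/eqP.
by apply: eq_bigr => k _; rewrite /utilde /wtilde -gap_mkw.
Qed.

Lemma gs_admm_reindexed_ergodic tau s x y lam lamh (t : nat) (w : wvec P) :
  Kbar R (tau, s) -> gs_admm_reindexed beta sigma1 sigma2 tau s x y lam lamh ->
  (1 <= t)%N -> calM P w ->
  hobj (ergodic_mean (utilde x y) t) - hobj (wu w) +
    dotv (ergodic_mean (what beta x y lamh) t - w) (calJ w) <=
  1 / (2 * t%:R) *
    (qnorm2 (Hmx' P beta sigma1 sigma2 tau s)
       (w - mkw (x 1%N) (y 1%N) (lamh 1%N)) +
     xi3 beta s tau * enorm (resid (x 1%N) (y 1%N)) ^+ 2 +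
     xi4 s * qnorm2 (Hx P beta sigma1) (x 1%N - x 0%N)).
Proof.
move=> [/= ts0 s1 dom] gs t_gt0 [Xw Yw]; apply: ergodic_gap_le => //.
have st0 : 0 < s + tau by rewrite addrC.
have dom' : 0 < - s ^+ 2 - tau ^+ 2 - s * tau + s + tau + 1 by lra.
have := sum_gap_le Hy_sym Hx_sym Hy_psd Hx_psd hbeta st0 s1 dom'
  (gs_admm_reindexed_vi hf hg hX hY gs) t (wl w) Yw Xw.
rewrite /merit residC.
rewrite -[in qnorm2 _ (w - _)](mkwK w) mkwB qnorm2_Hmx' // qnorm2E enorm_sqr.
apply: le_trans; rewrite le_eqVlt; apply/orP; left; apply/eqP.
by apply: eq_bigr => k _; rewrite /utilde /what -gap_mkw gap_swap residC.
Qed.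

End GlobalConvergence.

Theorem mainTheorem3 (R : realType) (P : problem R)
    (beta sigma1 sigma2 : R)
    (hp : (1 <= np P)%N) (hq : (1 <= nq P)%N)
    (hf : forall i, closed_proper_convex (fobj P i))
    (hg : forall j, closed_proper_convex (gobj P j))
    (hA : forall i, \rank (Amx P i) = dimx P i)
    (hB : forall j, \rank (Bmx P j) = dimy P j)
    (hX : forall i, closed (Xset P i) /\ convex_set (Xset P i))
    (hY : forall j, closed (Yset P j) /\ convex_set (Yset P j))
    (hsol : solution_set P !=set0)
    (hbeta : 0 < beta)
    (hsigma1 : (np P)%:R - 1 < sigma1)
    (hsigma2 : (nq P)%:R - 1 < sigma2) :
  (Kdom R `|` Kbar R = Gdom R) /\
  (* GS-ADMM, shifted by one in x and lambda, is the re-indexed algorithm *)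
  (forall (tau s : R) (x : nat -> xvec P) (y : nat -> yvec P)
     (lam lamh : nat -> lvec P),
     gs_admm beta sigma1 sigma2 tau s x y lam lamh ->
     gs_admm_reindexed beta sigma1 sigma2 tau s
       (fun k => x k.+1) y (fun k => lam k.+1) lamh) /\
  (* (i) global convergence of GS-ADMM on the symmetric domain *)
  (Mstar P !=set0 ->
   forall (tau s : R), Gdom R (tau, s) ->
   forall (x : nat -> xvec P) (y : nat -> yvec P) (lam lamh : nat -> lvec P),
     gs_admm beta sigma1 sigma2 tau s x y lam lamh ->
     [/\ successive_diff2 x y k @[k --> \oo] --> (0 : R),
         enorm (resid (x k) (y k)) @[k --> \oo] --> (0 : R) &
         exists2 winf : wvec P, Mstar P winf &
           wtilde beta x y lam k @[k --> \oo] --> winf]) /\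
  (* global convergence of the re-indexed algorithm *)
  (Mstar P !=set0 ->
   forall (tau s : R), Kbar R (tau, s) ->
   forall (x : nat -> xvec P) (y : nat -> yvec P) (lam lamh : nat -> lvec P),
     gs_admm_reindexed beta sigma1 sigma2 tau s x y lam lamh ->
     [/\ successive_diff2 x y k @[k --> \oo] --> (0 : R),
         enorm (resid (x k) (y k)) @[k --> \oo] --> (0 : R) &
         exists2 winf : wvec P, Mstar P winf &
           what beta x y lamh k @[k --> \oo] --> winf]) /\
  (* (ii) ergodic rate of GS-ADMM on K *)
  (forall (tau s : R), Kdom R (tau, s) ->
   exists xi3 xi4 : R, [/\ 0 <= xi3, 0 <= xi4 &
   forall (x : nat -> xvec P) (y : nat -> yvec P) (lam lamh : nat -> lvec P),
     gs_admm beta sigma1 sigma2 tau s x y lam lamh ->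
     forall (t : nat), (1 <= t)%N -> forall w : wvec P, calM P w ->
       hobj (ergodic_mean (utilde x y) t) - hobj (wu w) +
         dotv (ergodic_mean (wtilde beta x y lam) t - w) (calJ w) <=
       1 / (2 * t%:R) *
         (qnorm2 (Hmx P beta sigma1 sigma2 tau s)
            (w - mkw (x 1%N) (y 1%N) (lam 1%N)) +
          xi3 * enorm (resid (x 1%N) (y 1%N)) ^+ 2 +
          xi4 * qnorm2 (Hy P beta sigma2) (y 1%N - y 0%N))]) /\
  (* (ii) ergodic rate of the re-indexed algorithm on the mirrored domain *)
  (forall (tau s : R), Kbar R (tau, s) ->
   exists xi3 xi4 : R, [/\ 0 <= xi3, 0 <= xi4 &
   forall (x : nat -> xvec P) (y : nat -> yvec P) (lam lamh : nat -> lvec P),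
     gs_admm_reindexed beta sigma1 sigma2 tau s x y lam lamh ->
     forall (t : nat), (1 <= t)%N -> forall w : wvec P, calM P w ->
       hobj (ergodic_mean (utilde x y) t) - hobj (wu w) +
         dotv (ergodic_mean (what beta x y lamh) t - w) (calJ w) <=
       1 / (2 * t%:R) *
         (qnorm2 (Hmx' P beta sigma1 sigma2 tau s)
            (w - mkw (x 1%N) (y 1%N) (lamh 1%N)) +
          xi3 * enorm (resid (x 1%N) (y 1%N)) ^+ 2 +
          xi4 * qnorm2 (Hx P beta sigma1) (x 1%N - x 0%N))]).
Proof.
split; first exact: Gdom_union.
split; first by move=> *; exact: gs_admm_reindex.
split; first by move=> Ms tau s Gts x y lam lamh; exact: gs_admm_global.
split; first by move=> Ms tau s Kts x y lam lamh; exact: gs_admm_reindexed_global.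
split=> tau s Kts.
  exists (xi3 beta tau s), (xi4 tau); have [/= ts0 t1 dom] := Kts; split.
  - exact: xi3_ge0.
  - exact: (@xi4_ge0 _ tau s).
  - by move=> x y lam lamh gs t t1' w Mw; exact: gs_admm_ergodic gs t1' Mw.
(* The constants of the exchanged scheme, with tau and s swapped. *)
exists (xi3 beta s tau), (xi4 s); have [/= ts0 s1 dom] := Kts.
have dom' : 0 < - s ^+ 2 - tau ^+ 2 - s * tau + s + tau + 1 by lra.
split.
- exact: xi3_ge0.
- exact: (@xi4_ge0 _ s tau).
- by move=> x y lam lamh gs t t1' w Mw; exact: gs_admm_reindexed_ergodic gs t1' Mw.
Qed.
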